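(* Let $c_n$ be the number of nonnesting permutations of the multiset $\{1,1,2,2,\dots,n,n\}$ that avoid the pattern $123$. As $n\to\infty$, \[ c_n\sim\frac{9+6\sqrt3}{8\sqrt{\pi}}\,6^n\,n^{-3/2}, \] i.e. the ratio of the two sides tends to $1$.
   Context: For $n\ge 0$, a nonnesting permutation of $\{1,1,2,2,\dots,n,n\}$ is a word $w=w_1w_2\cdots w_{2n}$ using each of the labels $1,\dots,n$ exactly twice such that there are no indices $i<j<k<\ell$ and labels $a\ne b$ with $w_i=w_\ell=a$ and $w_j=w_k=b$. The word $w$ avoids $123$ if there are no indices $i<j<k$ with $w_i<w_j<w_k$. *)

(* Defs.v *)
From mathcomp Require Import all_boot.

Set Implicit Arguments.
Unset Strict Implicit.
Unset Printing Implicit Defensive.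

(* Words of length 2n over the ordered alphabet 'I_n = {0, ..., n-1}, which
   stands for the labels {1, ..., n}; positions are likewise 0-based. *)

Definition each_twice (n : nat) (w : (2 * n).-tuple 'I_n) : bool :=
  [forall a : 'I_n, count_mem a w == 2].

Definition nonnesting (n : nat) (w : (2 * n).-tuple 'I_n) : bool :=
  ~~ [exists i : 'I_(2 * n), exists j : 'I_(2 * n),
      exists k : 'I_(2 * n), exists l : 'I_(2 * n),
      exists a : 'I_n, exists b : 'I_n,
      [&& i < j, j < k, k < l, a != b,
          tnth w i == a, tnth w l == a, tnth w j == b & tnth w k == b]].

Definition avoids123 (n : nat) (w : (2 * n).-tuple 'I_n) : bool :=
  ~~ [exists i : 'I_(2 * n), exists j : 'I_(2 * n), exists k : 'I_(2 * n),
      [&& i < j, j < k, tnth w i < tnth w j & tnth w j < tnth w k]].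

Definition nonnesting_avoiders (n : nat) : {set (2 * n).-tuple 'I_n} :=
  [set w : (2 * n).-tuple 'I_n | [&& each_twice w, nonnesting w & avoids123 w]].

Definition c (n : nat) : nat := #|nonnesting_avoiders n|.

(* Main.v *)
From HB Require Import structures.
Require Import Defs.
From mathcomp Require Import all_boot zify.
Set Implicit Arguments.
Unset Strict Implicit.
Unset Printing Implicit Defensive.

(** Reversing the order of the letters turns 123 into 321.  Deleting both copies
    of the first letter of a nonnesting 321-avoiding word leaves a smaller such
    word, and the possible reinsertions depend only on a small state, so [c n]
    counts the paths of length [n] in an explicit automaton.  The kernel method
    solves it: with [C = 1 + x C^2] and [M = 1 + (x + 3 x^2) M^2],
      sum_n (c n) x^n = C + 2 (C - 1)^2 M / (1 - M (2 C - 2 - x)).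
    At the dominant singularity [x = 1/6] one has [C = 3 - sqrt 3] and [M = 2],
    so the denominator stays positive there.  As
    [1 - 4 (x + 3 x^2) = (1 - 6 x) (1 + 2 x)], the coefficients of [M] are
    asymptotic to a multiple of [6^n n^(-3/2)], and this behaviour passes to
    products (dominated convergence) and to [1 / (1 - K)] (renewal argument).
    The Wallis product provides the factor [1 / sqrt pi]. *)
(** * Generating tree of the words *)

(** Coefficients are divided by [6 ^ n], so the dominant singularity sits at 1, and the reference
    sequence [p] is the Catalan numbers divided by [4 ^ n]. The state stays small because every
    letter in front of the second new copy, and every smaller letter behind a new first letter, must
    already be in order: only two lengths of ordered parts matter. The obstacle is the division by
    [1 - K] with [K = M (2 C - 2 - x)]. Instead of excluding zeros of [1 - K] in the closed unit
    disc, the proof uses that [K] has nonnegative coefficients with sum [s < 1]. Logarithmic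
    differentiation then leaves a convolution in which only the asymptotics of [K] is required,
    together with a bound of the right order for [1 / (1 - K)]. With [r = sqrt 3], the coefficients
    of [M] are asymptotic to [2 r / 3] times [p], and [s = 23/3 - 4 r]. The contributions of [M] and
    of [1 / (1 - K)] combine to [4/3 r ((2 - r) / (1 - s))^2], which is [(9 + 6 r) / 8]. *)

Definition inc_below (w : seq nat) (i : nat) := sorted leq [seq x <- w | x < i].

(** The test [inc_below w' x] says that [x] is not the largest letter of a pattern 321 ending in
    [w']. *)
Fixpoint avoids321 (w : seq nat) : bool :=
  if w is x :: w' then inc_below w' x && avoids321 w' else true.

Definition nonnest (T : eqType) (w : seq T) : Prop :=
  forall a b, a != b -> ~~ subseq [:: a; b; b; a] w.

Record valid (n : nat) (w : seq nat) : Prop := Valid {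
  valid_count : forall a, count_mem a w = (a < n).*2;
  valid_nonnest : nonnest w;
  valid_av321 : avoids321 w }.

(* [ins k t w] adds a new letter of rank [k]: one copy in front, the other one
   after the first [t] letters of [w]; the letters [>= k] are shifted. *)
Definition ins (k t : nat) (w : seq nat) : seq nat :=
  k :: map (bump k) (take t w) ++ k :: map (bump k) (drop t w).

(** The definition of [subseq] matches greedily; in this disjunctive form the first letter may be
    used or skipped freely. *)
Lemma subseq_cons_cons (T : eqType) (x y : T) s w :
  subseq (x :: s) (y :: w) = (x == y) && subseq s w || subseq (x :: s) w.
Proof.
rewrite /=; case: eqVneq => //= _.
have [//|/negP Hn] := boolP (subseq s w).
by apply/esym/negP => /(subseq_trans (subseq_cons s x)).
Qed.

Lemma inc_belowP w i :
  reflect (forall y z, z < y < i -> ~~ subseq [:: y; z] w) (inc_below w i).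
Proof.
rewrite /inc_below (sorted_pairwise leq_trans).
elim: w => [|x w IHw]; first by apply: ReflectT.
rewrite [filter _ _]/=; case: ifP => xi.
- rewrite pairwise_cons; apply: (iffP andP) => [[/allP Hx /IHw Hw] y z zyi|H].
    rewrite subseq_cons_cons negb_or Hw // andbT sub1seq.
    case: eqP => //= yx; apply/negP => zw.
    have : z \in [seq x <- w | x < i] by rewrite mem_filter zw andbT; lia.
    by move=> /Hx; lia.
  split.
    apply/allP => z; rewrite mem_filter => /andP[zi zw]; rewrite leqNgt.
    apply/negP => zx; have := H x z; rewrite zx xi => /(_ isT).
    by rewrite subseq_cons_cons eqxx sub1seq zw.
  apply/IHw => y z zyi; have := H y z zyi.
  by rewrite subseq_cons_cons negb_or => /andP[].
- apply: (iffP IHw) => H y z zyi; have := H y z zyi; rewrite subseq_cons_cons.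
    by case: eqP => //= yx; lia.
  by rewrite negb_or => /andP[].
Qed.

Lemma avoids321P w :
  reflect (forall x y z, z < y < x -> ~~ subseq [:: x; y; z] w) (avoids321 w).
Proof.
elim: w => [|a w IHw]; first by apply: ReflectT.
apply: (iffP andP) => [[/inc_belowP Hi /IHw Hw] x y z zyx|H].
  rewrite subseq_cons_cons negb_or Hw // andbT.
  by case: eqP => //= xa; apply: Hi; rewrite -xa.
split.
  apply/inc_belowP => y z zya; have := H a y z zya.
  by rewrite subseq_cons_cons eqxx negb_or => /andP[].
apply/IHw => x y z zyx; have := H x y z zyx.
by rewrite subseq_cons_cons negb_or => /andP[].
Qed.

Lemma avoids321_subseq s w : subseq s w -> avoids321 w -> avoids321 s.
Proof.
move=> sw /avoids321P Hw; apply/avoids321P => x y z /Hw; apply: contra => h.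
exact: subseq_trans sw.
Qed.

Lemma nonnest_subseq (T : eqType) (s w : seq T) :
  subseq s w -> nonnest w -> nonnest s.
Proof.
move=> sw Hw a b /Hw; apply: contra => h.
exact: subseq_trans sw.
Qed.

Lemma ltn_bump k x y : (bump k x < bump k y) = (x < y).
Proof. by rewrite /bump; lia. Qed.

Lemma bump_inj k : injective (bump k).
Proof. by move=> x y; rewrite /bump; lia. Qed.

Lemma inc_below_bump k w i : inc_below (map (bump k) w) (bump k i) = inc_below w i.
Proof.
rewrite /inc_below filter_map sorted_map.
rewrite (eq_filter (a2 := fun x => x < i)); last by move=> x /=; rewrite ltn_bump.
by apply: eq_sorted => x y /=; rewrite /bump; lia.
Qed.

Lemma avoids321_bump k w : avoids321 (map (bump k) w) = avoids321 w.
Proof. by elim: w => //= x w ->; rewrite inc_below_bump. Qed.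

Lemma nonnest_map (T T' : eqType) (f : T -> T') w :
  injective f -> nonnest (map f w) <-> nonnest w.
Proof.
move=> fI; split=> H a b ab.
  have := H (f a) (f b); rewrite (inj_eq fI) => /(_ ab).
  by apply: contra => h; rewrite -[[:: f a; _; _; _]]/(map f [:: a; b; b; a]) map_subseq.
apply/negP => /[dup] /mem_subseq Hm /subseqP[m Hsz].
rewrite -map_mask => E.
move: (congr1 size E); rewrite size_map; move: E.
have := @mask_subseq _ m w; case: (mask m w) => [|a' [|b' [|b'' [|a'' []]]]] // Hs.
move=> [Ea Eb Eb' Ea'] _; move: Hs.
have <- : b' = b'' by apply: fI; rewrite -Eb.
have <- : a' = a'' by apply: fI; rewrite -Ea.
by apply/negP/H; apply: contraNneq ab => E; rewrite Ea Eb E.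
Qed.

Lemma filter_ltn_bump k i w : i <= k ->
  [seq x <- map (bump k) w | x < i] = [seq x <- w | x < i].
Proof.
move=> ik; elim: w => //= x w ->.
have -> : (bump k x < i) = (x < i) by rewrite /bump; lia.
by case: ifP => // xi; congr (_ :: _); rewrite /bump; lia.
Qed.

Lemma filter_ltnS_bump0 j w :
  [seq x <- map (bump 0) w | x < j.+1] = map (bump 0) [seq x <- w | x < j].
Proof. by rewrite filter_map; congr map; apply: eq_filter => x. Qed.

(** The inserted 0 is smaller than every shifted letter, so it can only come first. *)
Lemma sorted_insert0 a b :
  sorted leq (map (bump 0) a ++ 0 :: map (bump 0) b) = (a == [::]) && sorted leq b.
Proof.
case: a => [|x a] /=.
  rewrite path_sortedE; last exact: leq_trans.
  rewrite all_predT sorted_map; apply: eq_sorted => x y; rewrite /bump; lia.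
rewrite cat_path /=; case: (path _ _ _) => //=.
have -> : last (bump 0 x) (map (bump 0) a) = bump 0 (last x a) by rewrite last_map.
by rewrite /bump /=; lia.
Qed.

Lemma count_ins k t w a :
  count_mem a (ins k t w) =
  if a == k then 2 else count_mem (unbump k a) w.
Proof.
rewrite /ins /= count_cat /= -[in RHS](cat_take_drop t w) count_cat !count_map.
rewrite [k == a]eq_sym; case: eqVneq => [->|ak].
  by rewrite !(eq_count (a1 := preim _ _) (a2 := pred0)) ?count_pred0 // => x /=;
    apply/eqP; rewrite /bump; lia.
by rewrite !add0n; congr (_ + _); apply: eq_count => x /=;
  apply/eqP/eqP; move: ak; rewrite /bump /unbump; lia.
Qed.

Lemma mem_valid n w a : valid n w -> (a \in w) = (a < n).
Proof. by case=> /(_ a) Hc _ _; rewrite -has_pred1 has_count Hc; case: (a < n). Qed.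

(** Deleting both copies of the first letter and closing the gap in the ranks inverts [ins];
    validity survives because both avoidance conditions pass to subsequences. *)
Lemma ins_deleteP n w : valid n.+1 w ->
  exists k t w', [/\ k <= n, t <= size w', w = ins k t w' & valid n w'].
Proof.
move=> Hw; have : 0 \in w by rewrite (mem_valid _ Hw).
case: w Hw => // k w1 Hw _; have kn : k < n.+1.
  by rewrite -(mem_valid k Hw) mem_head.
have Hc1 : count_mem k w1 = 1.
  by have := valid_count Hw k; rewrite /= eqxx kn => -[].
have kw : k \in w1 by rewrite -has_pred1 has_count Hc1.
case/splitPr: kw Hc1 Hw => u v.
rewrite count_cat /= eqxx => Hc Hw.
have [/count_memPn ku /count_memPn kv] : count_mem k u = 0 /\ count_mem k v = 0.
  by move: Hc; case: (count_mem k u) => [|?]; case: (count_mem k v) => [|?]; rewrite /=; lia.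
have bK s : k \notin s -> map (bump k) (map (unbump k) s) = s.
  move=> ks; rewrite -map_comp -[RHS]map_id; apply/eq_in_map => x xs /=.
  by apply: unbumpK; rewrite inE; apply: contraNneq ks => <-.
have E : k :: u ++ k :: v = ins k (size u) (map (unbump k) (u ++ v)).
  by rewrite /ins -map_take -map_drop take_size_cat // drop_size_cat // !bK.
exists k, (size u), (map (unbump k) (u ++ v)); split => //.
  by rewrite size_map size_cat leq_addr.
have Hs : subseq (map (bump k) (map (unbump k) (u ++ v))) (k :: u ++ k :: v).
  rewrite bK ?mem_cat ?negb_or ?ku //.
  apply: subseq_trans (subseq_cons _ _); apply: cat_subseq => //.
  exact: subseq_cons.
split.
- move=> a; have := valid_count Hw (bump k a); rewrite E count_ins.
  have /negPf -> : bump k a != k by rewrite /bump; lia.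
  by rewrite bumpK => ->; congr _.*2; move: kn; rewrite /bump; lia.
- by apply/(nonnest_map _ (@bump_inj k))/(nonnest_subseq Hs)/valid_nonnest/Hw.
- by rewrite -(avoids321_bump k); apply: avoids321_subseq Hs (valid_av321 Hw).
Qed.

Lemma not_uniq_subseq (T : eqType) (s : seq T) :
  ~~ uniq s -> exists b, subseq [:: b; b] s.
Proof.
elim: s => //= x s IHs; rewrite negb_and negbK => /orP[xs|/IHs[b bs]].
  by exists x; rewrite eqxx sub1seq.
by exists b; rewrite -[X in is_true X]/(subseq [:: b; b] (x :: s)) subseq_cons_cons bs orbT.
Qed.

Lemma uniq_subseq2 (T : eqType) (s : seq T) b : uniq s -> ~~ subseq [:: b; b] s.
Proof. by move=> us; apply/negP => /subseq_uniq /(_ us); rewrite /= inE eqxx. Qed.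

(** The final [k] of the pattern is matched no later than the displayed [k], so the rest of the
    pattern lies in [u]. *)
Lemma subseq_rcons_notin (T : eqType) (k : T) s u v :
  k \notin v -> subseq (rcons s k) (u ++ k :: v) -> subseq s u.
Proof.
move=> kv; elim: u s => [|x u IHu] [|y s] //=.
  have kN : ~~ subseq (rcons s k) v.
    by apply: contra kv => /mem_subseq; apply; rewrite mem_rcons mem_head.
  case: eqP => _ h; first by rewrite h in kN.
  by rewrite (subseq_trans (subseq_cons _ _) h) in kN.
by case: eqP => _; [exact: IHu | move/(IHu (y :: s))].
Qed.

(** The new letter cannot be the inner one of a nesting, since its first copy has nothing before it.
    It is the outer one exactly when some letter occurs twice between its copies. *)
Lemma nonnest_ins k t w : nonnest w ->
  nonnest (ins k t w) <-> uniq (take t w).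
Proof.
move=> Hw; have kb s : k \notin map (bump k) s.
  by apply/mapP => -[x _]; rewrite /bump; lia.
split=> H.
  apply: contraT => /not_uniq_subseq[b bs].
  have := H k (bump k b); rewrite neq_ltn => /(_ _)/negP[]; first by rewrite /bump; lia.
  rewrite /ins subseq_cons_cons eqxx -[[:: _; _; k]]/(map (bump k) [:: b; b] ++ [:: k]).
  by rewrite cat_subseq ?map_subseq //= eqxx sub0seq.
move=> a b ab; rewrite /ins.
have Hck : count_mem k (map (bump k) (take t w) ++ k :: map (bump k) (drop t w)) = 1.
  by rewrite count_cat /= eqxx !(count_memPn (kb _)).
apply/negP; rewrite subseq_cons_cons; have [ak|ak] /= := eqVneq a k.
  rewrite {a}ak in ab *; case/orP.
    move/(@subseq_rcons_notin _ k [:: b; b]) => /(_ (kb _)); apply/negP.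
    by rewrite uniq_subseq2 // map_inj_uniq //; exact: bump_inj.
  by move=> /(leq_count_subseq (pred1 k)); rewrite Hck /= eqxx; lia.
move=> Hs; have [bk|bk] := eqVneq b k.
  by move: (leq_count_subseq (pred1 k) Hs); rewrite Hck bk /= eqxx; lia.
have := (nonnest_map w (@bump_inj k)).2 Hw a b ab; apply/negP; rewrite negbK.
have : subseq [:: a; b; b; a]
    [seq x <- map (bump k) (take t w) ++ k :: map (bump k) (drop t w) | predC1 k x].
  by rewrite subseq_filter Hs /= !ak !bk.
have kf s : [seq x <- map (bump k) s | predC1 k x] = map (bump k) s.
  by apply/all_filterP/allP => x xs /=; apply/eqP => xk; move: xs; rewrite xk; apply/negP/kb.
by rewrite filter_cat /= eqxx /= !kf -map_cat cat_take_drop.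
Qed.

(** For [i <= k] the copies of [k] are not seen; for [i > k] the front copy of [k] stands before a
    0. *)
Lemma inc_below_ins k t w i : 0 < k -> 0 \in w ->
  inc_below (ins k t w) i = (i <= k) && inc_below w i.
Proof.
move=> k0 w0; case: leqP => ki /=.
  rewrite /inc_below /ins /= filter_cat /= ltnNge ki /= -filter_cat -map_cat cat_take_drop.
  by rewrite filter_ltn_bump.
apply/negP => /inc_belowP /(_ k 0); rewrite k0 ki => /(_ isT)/negP; apply.
rewrite /ins subseq_cons_cons eqxx sub1seq mem_cat inE orbCA -mem_cat -map_cat cat_take_drop.
by apply/orP; left; apply/orP; right; apply/mapP; exists 0; rewrite // /bump; lia.
Qed.

Lemma inc_below_ins0 t w j :
  inc_below (ins 0 t w) j.+1 =
  ([seq x <- take t w | x < j] == [::]) && inc_below w j.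
Proof.
rewrite /inc_below /ins /= filter_cat /= !filter_ltnS_bump0.
have pathE s : path leq 0 s = sorted leq s by case: s.
rewrite pathE sorted_insert0; case: eqP => //= E.
by rewrite -[in RHS](cat_take_drop t w) filter_cat E.
Qed.

(** A descent in the prefix followed by the second 0 would be a pattern 321. As the prefix has no
    repetition, weak and strict increase coincide there. *)
Lemma avoids321_ins0 t w : uniq (take t w) ->
  avoids321 (ins 0 t w) = sorted ltn (take t w) && avoids321 w.
Proof.
rewrite /ins -[in avoids321 w](cat_take_drop t w); move: (take t w) (drop t w) => u v {t w} uu.
rewrite /= {1}/inc_below (eq_filter (a2 := pred0)) // filter_pred0 /=.
rewrite ltn_sorted_uniq_leq uu /= {uu}.
elim: u => [|x u IHu] /=.
  by rewrite /inc_below (eq_filter (a2 := pred0)) // filter_pred0 /= avoids321_bump.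
rewrite IHu (path_sortedE leq_trans).
have -> : inc_below (map (bump 0) u ++ 0 :: map (bump 0) v) (bump 0 x) =
   ([seq y <- u | y < x] == [::]) && inc_below v x.
  by rewrite /inc_below filter_cat /= !filter_ltnS_bump0 sorted_insert0.
have -> : all (leq x) u = ([seq y <- u | y < x] == [::]).
  elim: u {IHu} => //= y u ->.
  by case: ltnP => //=; rewrite ?andbF.
rewrite /inc_below filter_cat; case: eqP => [->|//] /=.
by rewrite andbCA !andbA.
Qed.

Lemma sorted_take_ins0 t w j : t <= size w -> sorted ltn (take t w) ->
  j <= size (ins 0 t w) -> sorted ltn (take j (ins 0 t w)) = (j <= t.+1).
Proof.
move=> tw su jw; case: (leqP j t.+1) => jt.
  case: j {jw} jt => // j jt; rewrite /ins /= takel_cat ?size_map ?size_takel //.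
  rewrite -map_take (path_sortedE ltn_trans) sorted_map.
  apply/andP; split; first by apply/allP => _ /mapP[x _ ->].
  rewrite (eq_sorted (e' := ltn)); last by move=> x y /=; rewrite ltn_bump.
  by apply: (subseq_sorted ltn_trans _ su); exact: take_subseq.
apply/negP => H.
have /(subseq_sorted ltn_trans)/(_ H) : subseq [:: 0; 0] (take j (ins 0 t w)).
  case: j jt {jw H} => // j jt; rewrite /ins /= sub1seq.
  rewrite take_cat size_map size_takel // ltnNge (ltnW (jt : t < j)) /= mem_cat.
  by rewrite -(@prednK (j - t)) ?subn_gt0 //= mem_head orbT.
by [].
Qed.

(* [inl k]: the first letter is [k > 0].  [inr (l, r)]: the word is empty or
   starts with 0, [l] is the largest [i] such that the letters [< i] occur in
   weakly increasing order, and [r] is the length of the longest strictly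
   increasing prefix. *)
Definition state : Type := (nat + nat * nat)%type.

(** The clause [y <= k] says that the longest strictly increasing prefix has length 1. The default
    value in [head 0 w = 0] covers the empty word. The bound [i <= n] caps [l], because beyond [n]
    the test no longer changes. *)
Definition has_state (n : nat) (w : seq nat) (s : state) : Prop :=
  match s with
  | inl k => [/\ 0 < k, exists y v, w = k :: y :: v /\ y <= k &
                 forall i, inc_below w i = (i <= k)]
  | inr (l, r) => [/\ head 0 w = 0, l <= n,
      forall i, i <= n -> inc_below w i = (i <= l), r <= size w &
      forall t, t <= size w -> sorted ltn (take t w) = (t <= r)]
  end.

(** A triple [(k, t, s')] stands for the insertion [ins k t] leading to state [s']. A new 0 whose
    second copy comes after an old leading 0 (which becomes 1) resets [l] to 1; the second copy
    always ends the strictly increasing prefix, whose length is then [t + 1]. *)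
Definition moves (s : state) : seq (nat * nat * state) :=
  match s with
  | inl k => [seq (i, 0, inl i) | i <- iota 1 k] ++
             [:: (0, 0, inr (k.+1, 1)); (0, 1, inr (k.+1, 2))]
  | inr (l, r) => [seq (i, 0, inl i) | i <- iota 1 l] ++
                  [seq (i, 1, inl i) | i <- iota 1 l] ++
                  (0, 0, inr (l.+1, 1)) ::
                  [seq (0, t, inr (1, t.+1)) | t <- iota 1 r]
  end.

Lemma valid_ins n w k t : valid n w -> k <= n -> uniq (take t w) ->
  avoids321 (ins k t w) -> valid n.+1 (ins k t w).
Proof.
move=> Hw kn ut Ha; split=> //.
  move=> a; rewrite count_ins (valid_count Hw); case: eqP => [->|/eqP ak].
    by rewrite ltnS kn.
  by congr _.*2; move: ak kn; rewrite /unbump; lia.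
by apply/nonnest_ins => //; exact: valid_nonnest Hw.
Qed.

Lemma avoids321_ins_pos0 k w : avoids321 (ins k 0 w) = inc_below w k && avoids321 w.
Proof.
rewrite /ins take0 drop0 /= avoids321_bump /inc_below /= ltnn filter_ltn_bump //.
by rewrite andbA andbb.
Qed.

Lemma avoids321_ins_pos1 k v : 0 < k ->
  avoids321 (ins k 1 (0 :: v)) = inc_below (0 :: v) k && avoids321 v.
Proof.
move=> k0; rewrite /ins /= take0 drop0 /= avoids321_bump.
have -> : bump k 0 = 0 by rewrite /bump; lia.
have E0 s : [seq x <- s | x < 0] = [::] by elim: s.
rewrite /inc_below /= ltnn k0 filter_ltn_bump //= E0 /=.
by case E : (path leq 0 _) => //=; rewrite (path_sorted E).
Qed.

(** The prefix has no repetition, so a 0 remains behind the second copy of [k]. A prefix letter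
    [x >= k] would give the pattern [x + 1, k, 0]. Hence all prefix letters are below [k], so they
    are in order with that later 0, so they are 0, and there is at most one. *)
Lemma ins_pos_cases n w k t : valid n w -> 0 < k <= n -> t <= size w ->
  uniq (take t w) -> avoids321 (ins k t w) ->
  inc_below w k /\ (t = 0 \/ t = 1 /\ exists v, w = 0 :: v).
Proof.
move=> Hw /andP[k0 kn] tw ut /avoids321P Ha.
have w0 : 0 \in w by rewrite (mem_valid _ Hw); lia.
have Hi : inc_below w k.
  apply/inc_belowP => y z zyk; have := Ha k y z zyk; apply: contra => Hs.
  rewrite /ins subseq_cons_cons eqxx /=.
  have -> : [:: y; z] = map (bump k) [:: y; z].
    by rewrite /=; congr [:: _; _]; rewrite /bump; lia.
  rewrite (subseq_trans (map_subseq (bump k) Hs)) // -{1}(cat_take_drop t w) map_cat.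
  by apply: cat_subseq => //; exact: subseq_cons.
split=> //.
have v0 : 0 \in drop t w.
  have := valid_count Hw 0; rewrite -{1}(cat_take_drop t w) count_cat (count_uniq_mem _ ut).
  have -> : 0 < n by lia.
  by case v0: (0 \in drop t w) => //; rewrite (count_memPn (negbT v0)); case: (0 \in _).
have uk x : x \in take t w -> x < k.
  move=> xu; rewrite ltnNge; apply/negP => kx.
  have := Ha x.+1 k 0; rewrite k0 ltnS kx => /(_ isT)/negP; apply.
  apply: (subseq_trans _ (subseq_cons _ _)).
  rewrite -[[:: _; _; _]]/([:: x.+1] ++ [:: k; 0]); apply: cat_subseq.
    by rewrite sub1seq; apply/mapP; exists x; rewrite // /bump kx.
  rewrite subseq_cons_cons eqxx sub1seq /=; apply/orP; left; apply/mapP.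
  by exists 0 => //; rewrite /bump; lia.
move: w0 v0 uk Hi ut; rewrite /inc_below.
case: t tw {Ha Hw} => [|t] tw; first by left.
case: w tw => // x v /= tw w0 v0 uk; rewrite (uk x) ?mem_head //= (path_sortedE leq_trans).
case/andP => /allP Hx Hs /andP[xu ut].
have x0 : x = 0.
  move: w0; rewrite inE => /orP[/eqP->//|w0].
  by have := Hx 0; rewrite mem_filter k0 w0 => /(_ isT); lia.
right; split; last by exists v; rewrite x0.
case: t tw v0 uk xu ut => // t; case: v Hs Hx w0 => // y v /= Hs Hx w0 _ v0 uk xu ut.
move: Hs; rewrite uk; last by rewrite !inE eqxx orbT.
rewrite /= (path_sortedE leq_trans) => /andP[/allP Hy _].
have := Hy 0; rewrite mem_filter k0 (mem_drop v0) => /(_ isT) y0.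
by move: xu; rewrite x0 inE eq_sym -leqn0 y0.
Qed.

Lemma moves_complete n w s k t : valid n w -> has_state n w s -> k <= n ->
  t <= size w -> valid n.+1 (ins k t w) -> exists s', (k, t, s') \in moves s.
Proof.
move=> Hw Hs kn tw Hi.
have ut : uniq (take t w) by apply/(nonnest_ins k _ (valid_nonnest Hw))/valid_nonnest/Hi.
have [k0|k0] := posnP k.
  move: (valid_av321 Hi); rewrite k0 avoids321_ins0 // => /andP[st _].
  case: s Hs => [j|[l r]] /= [].
    move=> j0 [y [v [Ew yj]]] _; have : t <= 1.
      rewrite leqNgt; apply/negP => t2; move: st; rewrite Ew.
      by case: (t) t2 => [|[|?]] //= _; rewrite ltnNge yj.
    case: (t) => [|[|//]] _; [exists (inr (j.+1, 1)) | exists (inr (j.+1, 2))];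
      by rewrite mem_cat !inE eqxx ?orbT.
  move=> _ _ _ _ /(_ t tw); rewrite st => /esym tr.
  have [t0|t0] := posnP t.
    by rewrite t0; exists (inr (l.+1, 1)); rewrite !mem_cat inE eqxx !orbT.
  exists (inr (1, t.+1)); rewrite !mem_cat inE; apply/orP; right; apply/orP; right.
  apply/orP; right; apply/mapP; exists t => //; rewrite mem_iota; lia.
have k0n : 0 < k <= n by rewrite k0.
have [Hk Ht] := ins_pos_cases Hw k0n tw ut (valid_av321 Hi).
exists (inl k); case: s Hs => [j|[l r]] /= [].
  move=> j0 [y [v [Ew yj]]] /(_ k); rewrite Hk => /esym kj.
  have -> : t = 0 by case: Ht => // -[_ [v']]; rewrite Ew => -[E]; rewrite E in j0.
  by rewrite mem_cat; apply/orP; left; apply/mapP; exists k; rewrite // mem_iota; lia.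
move=> _ _ /(_ k kn); rewrite Hk => /esym kl _ _.
have kI : k \in iota 1 l by rewrite mem_iota; lia.
rewrite !mem_cat; case: Ht => [->|[-> _]]; first by rewrite map_f.
by apply/orP; right; rewrite (map_f (fun i => (i, 1, inl i))).
Qed.

Lemma moves_sound n w s m : valid n w -> has_state n w s -> m \in moves s ->
  [/\ m.1.1 <= n, m.1.2 <= size w, valid n.+1 (ins m.1.1 m.1.2 w) &
      has_state n.+1 (ins m.1.1 m.1.2 w) m.2].
Proof.
move=> Hw Hs Hm.
have stateP k t : 0 < k <= n -> t <= 1 -> (t = 1 -> exists v, w = 0 :: v) ->
    (forall i, i <= k -> inc_below w i) -> has_state n.+1 (ins k t w) (inl k).
  move=> /andP[k0 kn] t1 tw Hi; split => //.
    case: t t1 tw => [|[|//]] _ tw; rewrite /ins.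
      by rewrite take0; exists k, (map (bump k) (drop 0 w)).
    have [v Ew] := tw erefl; rewrite Ew /= take0 /=.
    by eexists _, _; split; [reflexivity | rewrite /bump; lia].
  move=> i; rewrite inc_below_ins //; last by rewrite (mem_valid _ Hw); lia.
  by case: leqP => //= /Hi.
have moveP k t : 0 < k <= n -> t <= 1 -> (t = 1 -> exists v, w = 0 :: v) ->
    inc_below w k -> valid n.+1 (ins k t w).
  move=> /andP[k0 kn] t1 tw Hi; apply: (valid_ins Hw) => //.
    by case: t t1 tw => [|[|//]] _ tw; [rewrite take0 | case: (tw erefl) => v ->; rewrite /= take0].
  case: t t1 tw => [|[|//]] _ tw; first by rewrite avoids321_ins_pos0 Hi (valid_av321 Hw).
  have [v Ew] := tw erefl; move: Hi (valid_av321 Hw); rewrite Ew avoids321_ins_pos1 // => -> /=.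
  by case/andP.
have min_valid t : uniq (take t w) -> sorted ltn (take t w) -> valid n.+1 (ins 0 t w).
  by move=> ut st; apply: (valid_ins Hw) => //; rewrite avoids321_ins0 // st (valid_av321 Hw).
have new_min t l : t <= size w -> sorted ltn (take t w) -> l <= n.+1 ->
    (forall i, i <= n -> inc_below (ins 0 t w) i.+1 = (i.+1 <= l)) ->
    has_state n.+1 (ins 0 t w) (inr (l, t.+1)).
  move=> tw st ln Hi; split=> //.
  - case=> [|i]; last by rewrite ltnS; exact: Hi.
    by rewrite /inc_below (eq_filter (a2 := pred0)) // filter_pred0.
  - by rewrite /ins /= size_cat size_map size_takel //= ltnS leq_addr.
  - by move=> j; exact: sorted_take_ins0.
case: s Hs Hm => [j|[l r]] /= [].
  move=> j0 [y [v [Ew yj]]] Hi; rewrite mem_cat => /orP[/mapP[i]|].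
    rewrite mem_iota => iP -> /=; have jn : j < n.
      by rewrite -(mem_valid _ Hw) Ew mem_head.
    have [i0n ij] : 0 < i <= n /\ i <= j by lia.
    by split=> //; [lia | apply: moveP => //; rewrite Hi |
      apply: stateP => // i' i'i; rewrite Hi; lia].
  have jn : j < n by rewrite -(mem_valid _ Hw) Ew mem_head.
  rewrite !inE => /orP[]/eqP-> /=.
    split=> //; first by apply: min_valid; rewrite take0.
    by apply: new_min; rewrite ?take0 //; [lia | move=> i _; rewrite inc_below_ins0 take0 Hi].
  have t1 : take 1 w = [:: j] by rewrite Ew /= ?take0.
  split=> //; [by rewrite Ew | by apply: min_valid; rewrite t1 | ].
  apply: new_min; rewrite ?t1 //; [by rewrite Ew | lia | move=> i _].
  by rewrite inc_below_ins0 t1 Hi /=; case: ltnP => //=; lia.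
move=> hw ln Hi rw Hst.
have w0 : 0 < n -> exists v, w = 0 :: v.
  rewrite -(mem_valid 0 Hw); case: (w) hw => [|x v] //= -> _; by exists v.
rewrite !mem_cat => /or3P[/mapP[i]|/mapP[i]|].
- rewrite mem_iota => iP -> /=; have i0n : 0 < i <= n by lia.
  by split=> //; [lia | apply: moveP => //; rewrite Hi; lia |
    apply: stateP => // i' i'i; rewrite Hi; lia].
- rewrite mem_iota => iP -> /=; have i0n : 0 < i <= n by lia.
  have [v Ew] : exists v, w = 0 :: v by apply: w0; lia.
  split=> //; [lia | by rewrite Ew | |].
    by apply: moveP => //; [exists v | rewrite Hi; lia].
  by apply: stateP => //; [exists v | move=> i' i'i; rewrite Hi; lia].
- rewrite inE => /orP[/eqP->|/mapP[t]] /=.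
    split=> //; first by apply: min_valid; rewrite take0.
    by apply: new_min; rewrite ?take0 // => i ni; rewrite inc_below_ins0 take0 Hi.
  rewrite mem_iota => tP -> /=; have tw : t <= size w by lia.
  have st : sorted ltn (take t w) by rewrite Hst //; lia.
  split=> //; first by apply: min_valid => //; apply: (sorted_uniq ltn_trans ltnn).
  apply: new_min => // i ni; rewrite inc_below_ins0.
  case: i ni => [|i] ni; last first.
    have [v ->] : exists v, w = 0 :: v by apply: w0; lia.
    by case: (t) tP.
  rewrite (eq_filter (a2 := pred0)) // filter_pred0 /=.
  by rewrite /inc_below (eq_filter (a2 := pred0)) // filter_pred0.
Qed.

(** * Words as paths of the automaton *)

Fixpoint words (n : nat) : seq (seq nat * state) :=
  if n is n'.+1 then
    [seq (ins m.1.1 m.1.2 p.1, m.2) | p <- words n', m <- moves p.2]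
  else [:: ([::], inr (0, 0))].

Fixpoint paths (k : nat) (s : state) : nat :=
  if k is k'.+1 then \sum_(m <- moves s) paths k' m.2 else 1.

Lemma size_words n : size (words n) = paths n (inr (0, 0)).
Proof.
(* The paths are cut after [n] steps, which lets the induction move the cut: [words] grows at the
   end of a path, [paths] recurses at its start. *)
suff H k : \sum_(p <- words n) paths k p.2 = paths (k + n) (inr (0, 0)).
  by rewrite -(H 0) /= sum1_size.
elim: n k => [|n IHn] k; first by rewrite big_seq1 addn0.
by rewrite addnS -addSn -IHn /= big_allpairs_dep.
Qed.

Lemma words_sound n p : p \in words n -> valid n p.1 /\ has_state n p.1 p.2.
Proof.
elim: n p => [|n IHn] p /=.
  rewrite inE => /eqP->; split; first by split.
  by split=> //; case.
case/allpairsPdep => q [m [/IHn[Hq1 Hq2] mq ->]] /=.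
by have [] := moves_sound Hq1 Hq2 mq.
Qed.

Lemma words_complete n w : valid n w -> exists s, (w, s) \in words n.
Proof.
elim: n w => [|n IHn] w Hw.
  exists (inr (0, 0)); rewrite inE; case: w Hw => // x w Hw.
  by have := mem_valid x Hw; rewrite mem_head.
have [k [t [w' [kn tw Ew Hw']]]] := ins_deleteP Hw.
have [s ws] := IHn _ Hw'; have [_ Hs] := words_sound ws.
rewrite Ew in Hw *; have [s' ms'] := moves_complete Hw' Hs kn tw Hw.
by exists s'; apply/allpairsPdep; exists (w', s), (k, t, s').
Qed.

(** After shifting, [k] does not occur in the old letters, so its second copy marks the position
    [t]. *)
Lemma ins_inj k t w k' t' w' : t <= size w -> t' <= size w' ->
  ins k t w = ins k' t' w' -> [/\ k = k', t = t' & w = w'].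
Proof.
move=> tw tw' [<- {k'}]; have kb s : k \notin map (bump k) s.
  by apply/mapP => -[x _]; rewrite /bump; lia.
move=> E; have ixE u v : index k (map (bump k) u ++ k :: map (bump k) v) = size u.
  by rewrite index_cat (negPf (kb u)) size_map /= eqxx addn0.
have Et : t = t'.
  by have := ixE (take t w) (drop t w); rewrite E ixE !size_takel.
split=> //; move: E; rewrite -Et => /eqP; rewrite eqseq_cat; last first.
  by rewrite !size_map !size_takel // Et.
case/andP => /eqP/(inj_map (@bump_inj k)) E1 /eqP[/(inj_map (@bump_inj k)) E2].
by rewrite -(cat_take_drop t w) E1 E2 cat_take_drop.
Qed.

(** The pairs [(k, t)] alone separate the moves, so by [ins_inj] distinct paths build distinct
    words. *)
Lemma moves_uniq s : uniq (map fst (moves s)).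
Proof.
case: s => [k|[l r]]; rewrite /moves !map_cat /= -!map_comp !cat_uniq /=.
  rewrite map_inj_uniq ?iota_uniq /=; last by move=> i j [].
  by rewrite !orbF negb_or andbT; apply/andP; split; apply/mapP => -[i];
     rewrite mem_iota => ? [] *; lia.
rewrite !map_inj_uniq ?iota_uniq; try by move=> i j [].
rewrite /= !andbT; apply/and3P; split.
- apply/hasPn => x; rewrite mem_cat => /orP[/mapP[i _ ->]|].
    by apply/mapP => -[].
  rewrite inE => /orP[/eqP->|/mapP[i _ ->]]; apply/mapP => -[j];
    by rewrite mem_iota => ? [] *; lia.
- rewrite negb_or; apply/andP; split; first by apply/mapP => -[i];
    rewrite mem_iota => ? [] *; lia.
  by apply/hasPn => _ /mapP[i _ ->]; apply/mapP => -[j]; rewrite mem_iota => ? [] *; lia.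
- by apply/mapP => -[i]; rewrite mem_iota => ? [] *; lia.
Qed.

Lemma map_fst_inj (T U : eqType) (s : seq (T * U)) p q : uniq (map fst s) ->
  p \in s -> q \in s -> p.1 = q.1 -> p = q.
Proof.
elim: s => //= a s IHs /andP[an us]; rewrite !inE.
case/orP => [/eqP->|ps] /orP[/eqP->|qs] // E.
- by case/negP: an; rewrite E map_f.
- by case/negP: an; rewrite -E map_f.
- exact: IHs.
Qed.

Lemma words_uniq n : uniq (map fst (words n)).
Proof.
elim: n => [|n IHn] //=.
rewrite map_flatten -map_comp /=.
rewrite (eq_map (g := fun p => [seq ins m.1.1 m.1.2 p.1 | m <- moves p.2])); last first.
  by move=> p /=; rewrite -map_comp.
rewrite -[flatten _]/[seq ins m.1.1 m.1.2 p.1 | p <- words n, m <- moves p.2].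
apply: (@allpairs_uniq_dep _ (fun=> _)); first exact: map_uniq IHn.
  by move=> p _; apply: map_uniq (moves_uniq _).
move=> _ _ /allpairsPdep[p [m [pw mp ->]]] /allpairsPdep[q [m' [qw mq ->]]] /=.
have [Hp Sp] := words_sound pw; have [Hq Sq] := words_sound qw.
have [_ tp _ _] := moves_sound Hp Sp mp; have [_ tq _ _] := moves_sound Hq Sq mq.
case/ins_inj => // Ek Et Ew.
have Epq : p = q by apply: (map_fst_inj IHn).
rewrite -Epq in mq *; congr Tagged; apply: (map_fst_inj (moves_uniq p.2)) => //.
by rewrite [LHS]surjective_pairing [RHS]surjective_pairing Ek Et.
Qed.

(** * Words and tuples *)

(** Translates between the increasing positions of the definitions on tuples and the subsequences
    used for words. *)
Lemma subseq_nthP (T : eqType) (x0 : T) (s w : seq T) :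
  reflect (exists idx, [/\ sorted ltn idx, all (fun i => i < size w) idx &
                           s = map (nth x0 w) idx])
          (subseq s w).
Proof.
apply: (iffP idP) => [/subseqP[m _ ->]|[idx [si /allP ai ->]]].
  exists (mask m (iota 0 (size w))); split.
  - exact: subseq_sorted ltn_trans _ _ (mask_subseq _ _) (iota_ltn_sorted _ _).
  - by apply/allP => i /mem_mask; rewrite mem_iota.
  - by rewrite map_mask map_nth_iota0 ?take_size.
rewrite -[X in subseq _ X](take_size w) -(map_nth_iota0 x0) //.
apply: map_subseq; suff -> : idx = [seq i <- iota 0 (size w) | i \in idx].
  exact: filter_subseq.
apply: (irr_sorted_eq ltn_trans ltnn) => //.
  by apply: sorted_filter (iota_ltn_sorted _ _); exact: ltn_trans.
move=> i; rewrite mem_filter mem_iota /= add0n.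
by case: (boolP (i \in idx)) => // /ai ->.
Qed.

Section Tuples.
Variable n : nat.
Implicit Type w : (2 * n).-tuple 'I_n.

Definition rev_word w : seq nat := [seq val (rev_ord a) | a <- w].

Lemma val_rev_inj : injective (fun a : 'I_n => val (rev_ord a)).
Proof. by move=> a b /val_inj/rev_ord_inj. Qed.

Lemma ltn_val_rev (a b : 'I_n) : (val (rev_ord a) < val (rev_ord b)) = (b < a).
Proof. by move: (ltn_ord a) (ltn_ord b); rewrite /=; lia. Qed.

Lemma rev_word_inj : injective rev_word.
Proof. by move=> w w' /(inj_map val_rev_inj)/val_inj. Qed.

Lemma each_twiceP w :
  each_twice w <-> (forall a, count_mem a (rev_word w) = (a < n).*2).
Proof.
split=> [/forallP H a|H].
  have [an|na] := ltnP a n; last first.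
    apply/count_memPn/mapP => -[b _ Ea]; move: (ltn_ord (rev_ord b)) na.
    by rewrite -[X in X < _ -> _]/(val (rev_ord b)) -Ea; lia.
  rewrite -[RHS]/2 -(eqP (H (rev_ord (Ordinal an)))) count_map; apply: eq_count => b.
  rewrite -[LHS]/(val (rev_ord b) == val (Ordinal an)) (inj_eq val_inj).
  by rewrite (can2_eq rev_ordK rev_ordK).
apply/forallP => a; have := H (rev_ord a); rewrite ltn_ord => E.
apply/eqP; rewrite -[RHS]E count_map; apply: eq_count => b /=.
by rewrite (inj_eq val_rev_inj).
Qed.

Lemma nonnestingP w : nonnesting w <-> nonnest (rev_word w).
Proof.
rewrite (nonnest_map w val_rev_inj); split=> [/existsP H a b ab|H].
  apply/negP => /(subseq_nthP a)[[|i [|j [|k [|l [|? ?]]]]] [si]] //= /and5P[il jl kl ll _].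
  rewrite !size_tuple in il jl kl ll; case=> Ea Eb Eb' Ea'; apply: H.
  exists (Ordinal il); apply/existsP; exists (Ordinal jl); apply/existsP.
  exists (Ordinal kl); apply/existsP; exists (Ordinal ll); apply/existsP.
  exists a; apply/existsP; exists b.
  rewrite ab !(tnth_nth a) /= -Ea -Eb -Eb' -Ea' !eqxx /=.
  by move: si => /= /and4P[-> -> -> _].
apply/existsP => -[i /existsP[j /existsP[k /existsP[l /existsP[a /existsP[b]]]]]].
case/and5P => ij jk kl ab /and4P[/eqP Ei /eqP El /eqP Ej /eqP Ek].
have /negP := H _ _ ab; apply; apply/(subseq_nthP a).
exists [:: val i; val j; val k; val l]; rewrite /= ij jk kl size_tuple !ltn_ord.
by split=> //; rewrite -!tnth_nth Ei Ej Ek El.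
Qed.

Lemma avoids123P w : avoids123 w <-> avoids321 (rev_word w).
Proof.
split=> [/existsP H|/avoids321P H].
  apply/avoids321P => x y z zyx; apply/negP.
  move=> /(subseq_nthP 0)[[|i [|j [|k [|? ?]]]] [si]] //= /and4P[il jl kl _].
  rewrite size_map size_tuple in il jl kl.
  have [d _] : exists d : 'I_n, d = tnth w (Ordinal il) by eexists.
  rewrite !(nth_map d) ?size_tuple // => -[Ex Ey Ez]; apply: H.
  exists (Ordinal il); apply/existsP; exists (Ordinal jl); apply/existsP.
  exists (Ordinal kl); move: si => /= /and3P[-> -> _] /=.
  rewrite -[X in X && _]ltn_val_rev -[X in _ && X]ltn_val_rev !(tnth_nth d) /= -Ex -Ey -Ez.
  by case/andP: zyx => -> ->.
apply/existsP => -[i /existsP[j /existsP[k /and4P[ij jk wij wjk]]]].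
have kji : val (rev_ord (tnth w k)) < val (rev_ord (tnth w j)) < val (rev_ord (tnth w i)).
  by rewrite !ltn_val_rev wjk wij.
have /negP[] := H _ _ _ kji.
apply/(subseq_nthP 0); exists [:: val i; val j; val k].
rewrite /= ij jk size_map size_tuple !ltn_ord; split=> //.
by rewrite !(nth_map (tnth w i)) ?size_tuple // -!tnth_nth.
Qed.

Lemma mem_nonnesting_avoiders w :
  w \in nonnesting_avoiders n <-> valid n (rev_word w).
Proof.
rewrite inE; split=> [/and3P[/each_twiceP H1 /nonnestingP H2 /avoids123P H3] // | [H1 H2 H3]].
by apply/and3P; split; [apply/each_twiceP | apply/nonnestingP | apply/avoids123P].
Qed.

Lemma size_valid v : valid n v -> size v = 2 * n.
Proof.
move=> Hv; rewrite mul2n -addnn -{1}(size_iota 0 n) -(size_iota 0 n) -size_cat size_iota.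
apply: perm_size; apply/allP => a _ /=; rewrite (valid_count Hv) count_cat.
by rewrite !(count_uniq_mem _ (iota_uniq _ _)) mem_iota addnn.
Qed.

Lemma rev_word_surj v : valid n v -> exists w, rev_word w = v.
Proof.
move=> Hv; pose s := [seq rev_ord a | a <- pmap insub v] : seq 'I_n.
have Es : [seq val (rev_ord a) | a <- s] = v.
  rewrite /s -map_comp (eq_map (g := val)); last first.
    by move=> a; rewrite -[LHS]/(val (rev_ord (rev_ord a))) rev_ordK.
  by rewrite pmap_filter; [apply/all_filterP/allP => a; rewrite (mem_valid _ Hv) isSome_insub |
    exact: insubK].
have sz : size s == 2 * n by rewrite -(size_valid Hv) -[X in _ == size X]Es size_map.
by exists (Tuple sz).
Qed.

Lemma c_paths : c n = paths n (inr (0, 0)).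
Proof.
rewrite -size_words -(size_map fst) /c cardE -(size_map rev_word).
apply: perm_size; apply: uniq_perm; rewrite ?words_uniq //.
  by rewrite (map_inj_uniq rev_word_inj) enum_uniq.
move=> v; apply/mapP/mapP => [[w]|[p /words_sound[Hp _] ->]].
  rewrite mem_enum => /mem_nonnesting_avoiders/words_complete[s ws] ->.
  by exists (rev_word w, s).
have [w Ew] := rev_word_surj Hp; exists w => //.
by rewrite mem_enum; apply/mem_nonnesting_avoiders; rewrite Ew.
Qed.

End Tuples.

From mathcomp Require Import all_order all_algebra.
From mathcomp Require Import all_classical all_reals all_analysis.
From mathcomp Require Import ring lra.
Import Order.TTheory GRing.Theory Num.Theory.
Import numFieldNormedType.Exports.
Local Open Scope classical_set_scope.
Local Open Scope ring_scope.

(** * Formal power series *)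

(** A separate name for sequences, so that their ring product is convolution rather than the
    pointwise product. *)
Definition fps (R : Type) : Type := nat -> R.

Section FormalPowerSeries.
Variable R : comNzRingType.
Implicit Types (u v w : fps R) (a : R) (n : nat).

HB.instance Definition _ := GRing.Zmodule.copy (fps R) (nat -> R).

Definition fps_const a : fps R := fun n => if n is 0%N then a else 0.

Definition fps_mul u v : fps R := fun n => \sum_(i < n.+1) u i * v (n - i)%N.

Definition fps_trunc n u : {poly R} := \poly_(i < n.+1) u i.

Lemma coef_fps_trunc n u m : (m <= n)%N -> (fps_trunc n u)`_m = u m.
Proof. by move=> mn; rewrite coef_poly ltnS mn. Qed.

(** Truncation reduces the ring laws to those of polynomials. *)
Lemma fps_mulE n u v m : (m <= n)%N ->
  fps_mul u v m = (fps_trunc n u * fps_trunc n v)`_m.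
Proof.
move=> mn; rewrite coefM; apply: eq_bigr => i _.
rewrite !coef_fps_trunc //; first by rewrite (leq_trans (leq_subr _ _)).
by rewrite (leq_trans _ mn) // -ltnS.
Qed.

Lemma fps_mulC : commutative fps_mul.
Proof. by move=> u v; apply/funext => n; rewrite !(@fps_mulE n) // mulrC. Qed.

Lemma fps_trunc_mul n u v m : (m <= n)%N ->
  (fps_trunc n (fps_mul u v))`_m = (fps_trunc n u * fps_trunc n v)`_m.
Proof. by move=> mn; rewrite coef_fps_trunc // -fps_mulE. Qed.

Lemma fps_mulA : associative fps_mul.
Proof.
have H n u v w : fps_mul (fps_mul u v) w n = (fps_trunc n u * fps_trunc n v * fps_trunc n w)`_n.
  rewrite (@fps_mulE n) // coefM [RHS]coefM; apply: eq_bigr => i _.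
  by rewrite fps_trunc_mul // -ltnS.
move=> u v w; apply/funext => n.
by rewrite H fps_mulC H mulrC mulrA.
Qed.

Lemma fps_mul1 : left_id (fps_const 1) fps_mul.
Proof.
move=> u; apply/funext => n; rewrite /fps_mul big_ord_recl /= subn0 mul1r.
by rewrite big1 ?addr0 // => i _; rewrite mul0r.
Qed.

Lemma fps_mulDl : left_distributive fps_mul +%R.
Proof.
move=> u v w; apply/funext => n; rewrite -[RHS]/(fps_mul u w n + fps_mul v w n) /fps_mul -big_split.
by apply: eq_bigr => i _; exact: mulrDl.
Qed.

Lemma fps_1neq0 : fps_const 1 != 0 :> fps R.
Proof. by apply/eqP => /(congr1 (fun f => f 0%N))/eqP; rewrite oner_eq0. Qed.

HB.instance Definition _ := GRing.Zmodule_isComNzRing.Build (fps R)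
  fps_mulA fps_mulC fps_mul1 fps_mulDl fps_1neq0.

Lemma fpsD u v n : (u + v) n = u n + v n. Proof. by []. Qed.
Lemma fpsN u n : (- u) n = - u n. Proof. by []. Qed.
Lemma fpsM u v n : (u * v) n = \sum_(i < n.+1) u i * v (n - i)%N. Proof. by []. Qed.
Lemma fps1 n : (1 : fps R) n = (n == 0%N)%:R. Proof. by case: n. Qed.

Lemma fps_sum I (r : seq I) (P : pred I) (F : I -> fps R) n :
  (\sum_(i <- r | P i) F i) n = \sum_(i <- r | P i) F i n.
Proof. by elim/big_rec2: _ => // i x y _ <-. Qed.

Lemma fps_constM a u n : (fps_const a * u) n = a * u n.
Proof.
rewrite fpsM big_ord_recl /= subn0 big1 ?addr0 // => i _.
by rewrite mul0r.
Qed.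

Fact fps_const_is_zmod : zmod_morphism fps_const.
Proof. by move=> a b; apply/funext => -[|n] //=; rewrite fpsD fpsN /= subr0. Qed.
Fact fps_const_is_monoid : monoid_morphism fps_const.
Proof.
split=> // a b; apply/funext => n; rewrite fps_constM.
by case: n => //=; rewrite mulr0.
Qed.
HB.instance Definition _ := GRing.isZmodMorphism.Build R (fps R) fps_const fps_const_is_zmod.
HB.instance Definition _ := GRing.isMonoidMorphism.Build R (fps R) fps_const fps_const_is_monoid.

Definition fpsX : fps R := fun n => (n == 1%N)%:R.

Lemma fpsXM u n : (fpsX * u) n = if n is m.+1 then u m else 0.
Proof.
case: n => [|n]; rewrite fpsM big_ord_recl /= mul0r add0r; first by rewrite big_ord0.
by rewrite big_ord_recl /= mul1r subSS subn0 big1 ?addr0 // => i _; rewrite mul0r.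
Qed.

Lemma fpsX_inj : injective (fun u => fpsX * u).
Proof.
move=> u v /(congr1 (fun f : fps R => f)) E; apply/funext => n.
by have := congr1 (fun f : fps R => f n.+1) E; rewrite !fpsXM.
Qed.

(** The Euler operator [X d/dX], a derivation that does not shift the index. *)
Definition fps_theta u : fps R := fun n => n%:R * u n.

Lemma fps_thetaM u v : fps_theta (u * v) = fps_theta u * v + u * fps_theta v.
Proof.
apply/funext => n; rewrite fpsD !fpsM /fps_theta fpsM big_distrr -big_split.
apply: eq_bigr => i _ /=.
rewrite -{1}(subnKC (_ : i <= n)%N) -1?ltnS // natrD; ring.
Qed.

End FormalPowerSeries.

(** * Catalan series *)

Section GeneratingFunction.
Variable R : realType.
Local Notation fX := (fpsX R).
Local Notation "c %:S" := (fps_const c) (at level 1, format "c %:S").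

(** As [u ^+ k] vanishes below degree [k], each coefficient of the partial geometric sums is
    eventually constant. *)
Lemma fps_geometric_inverse (u : fps R) : u 0%N = 0 ->
  exists f : fps R, f = 1 + u * f.
Proof.
move=> u0; have uX k n : (n < k)%N -> (u ^+ k) n = 0.
  elim: k n => // k IHk n nk; rewrite exprS fpsM big1 // => -[[|i] /= ik] _.
    by rewrite u0 mul0r.
  by rewrite IHk ?mulr0 //; lia.
pose S N : fps R := \sum_(k < N) u ^+ k.
have SS N n : (n < N)%N -> S N n = S n.+1 n.
  elim: N => // N IHN; rewrite ltnS leq_eqVlt => /orP[/eqP-> // | nN].
  by rewrite /S big_ord_recr /= fpsD -/(S N) uX ?addr0 ?IHN.
have SE N : S N = 1 + u * S N - u ^+ N.
  elim: N => [|N IHN]; first by rewrite /S big_ord0 mulr0 expr0 addr0 subrr.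
  by rewrite {1 2}/S !big_ord_recr /= -/(S N) {1}IHN exprS; ring.
exists (fun n => S n.+1 n); apply/funext => n.
rewrite {1}SE fpsD fpsN uX // subr0 !fpsD !fpsM; congr (_ + _).
by apply: eq_bigr => i _; congr (_ * _); apply: SS; lia.
Qed.

(** The Catalan numbers through the ratio of consecutive terms, from which their growth is read off;
    the quadratic equation is derived next. *)
Fixpoint catalan (n : nat) : R :=
  if n is m.+1 then (4 * m + 2)%:R / m.+2%:R * catalan m else 1.

Definition catalan_fps (a : R) : fps R := fun n => catalan n * a ^+ n.

(** The series [g = 1 - 2 a X C] plays the role of [sqrt (1 - 4 a X)]. The recurrence gives a
    first-order differential equation for [g], hence one for [w = g^2], whose coefficients are then
    forced to be those of [1 - 4 a X]. *)
Lemma catalan_fpsE a : a != 0 ->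
  catalan_fps a = 1 + a%:S * fX * catalan_fps a ^+ 2.
Proof.
move=> a0; set C := catalan_fps a.
pose g := 1 - 2%:R%:S * (a%:S * (fX * C)).
have g0 : g 0%N = 1 by rewrite /g fpsD fpsN !fps_constM fpsXM fps1 !mulr0 subr0.
have gS n : g n.+1 = - (2 * (a * C n)) by rewrite /g fpsD fpsN !fps_constM fpsXM fps1 sub0r.
have gE : fps_theta g = a%:S * (fX * (4%:R%:S * fps_theta g - 2%:R%:S * g)).
  apply/funext => -[|n]; rewrite fps_constM fpsXM; first by rewrite /fps_theta mul0r mulr0.
  rewrite fpsD fpsN !fps_constM /fps_theta gS.
  case: n => [|n]; first by rewrite g0 /C /catalan_fps /= expr0; ring.
  rewrite gS /C /catalan_fps /= exprS; field.
  by rewrite -natrD pnatr_eq0.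
pose w := g * g.
have wE : fps_theta w = a%:S * (fX * (4%:R%:S * fps_theta w - 4%:R%:S * w)).
  have tw : fps_theta w = 2%:R%:S * (g * fps_theta g).
    by rewrite /w fps_thetaM rmorph_nat; ring.
  by rewrite {2}tw {1}tw [in LHS]gE /w !rmorph_nat; ring.
have wS n : n.+1%:R * w n.+1 = a * (4 * (n%:R - 1)) * w n.
  have := congr1 (fun u : fps R => u n.+1) wE.
  rewrite fps_constM fpsXM fpsD fpsN !fps_constM /fps_theta => ->; ring.
have w0 : w 0%N = 1 by rewrite /w fpsM big_ord1 g0 mulr1.
have w1 : w 1%N = - (4 * a) by have := wS 0%N; rewrite w0 mul1r => ->; ring.
have w2 n : w n.+2 = 0.
  elim: n => [|n IHn]; first by have := wS 1%N; rewrite subrr mulr0 mulr0 mul0r;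
    move/eqP; rewrite mulf_eq0 pnatr_eq0 => /eqP.
  have := wS n.+2; rewrite IHn mulr0 => /eqP; rewrite mulf_eq0 pnatr_eq0; exact: eqP.
have wX : w = 1 - 4%:R%:S * (a%:S * fX).
  apply/funext => -[|[|n]]; rewrite fpsD fpsN !fps_constM fps1 /fpsX.
  - by rewrite w0 !mulr0 subr0.
  - by rewrite w1 mulr1 sub0r.
  - by rewrite w2 !mulr0 subr0.
have E : fX * (4%:R%:S * (a%:S * C)) =
         fX * (4%:R%:S * (a%:S * (1 + a%:S * fX * C ^+ 2))).
  have : w = g * g by []. rewrite wX /g !rmorph_nat => E.
  apply/eqP; rewrite -subr_eq0; apply/eqP.
  transitivity ((1 - 4%:R * (a%:S * fX)) - (1 - 2%:R * (a%:S * (fX * C))) *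
    (1 - 2%:R * (a%:S * (fX * C)))); last by rewrite E subrr.
  by ring.
have {}E := fpsX_inj E; apply/funext => n.
have := congr1 (fun u : fps R => u n) E; rewrite !fps_constM.
have n4 : (4%:R : R) != 0 by rewrite pnatr_eq0.
by move/(mulfI n4)/(mulfI a0).
Qed.
End GeneratingFunction.

(** * Generating function of the paths *)

Section PathSeries.
Variable R : realType.
Local Notation fX := (fpsX R).
Local Notation "c %:S" := (fps_const c) (at level 1, format "c %:S").

Definition geometric_fps (a : R) : fps R := fun n => a ^+ n.

Lemma geometric_fpsE a : geometric_fps a = 1 + a%:S * fX * geometric_fps a.
Proof.
apply/funext => n; rewrite fpsD fps1 -mulrA fps_constM fpsXM /geometric_fps.
by case: n => [|n]; rewrite ?mulr0 ?addr0 // exprS add0r.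
Qed.

Lemma fps_scaleX_inj (a : R) : a != 0 -> injective (fun u => a%:S * fX * u).
Proof.
move=> a0 u v; rewrite -!mulrA => E; apply: (@fpsX_inj R); apply/funext => n.
have := congr1 (fun w : fps R => w n) E.
by rewrite !fps_constM; apply: mulfI.
Qed.

Local Notation x := (6%:R^-1%:S * fX).
Local Notation y := (12%:R^-1%:S * fX).

(* [1 - 4 (x + 3 x^2) = (1 - 4 (3 x / 2)) (1 - 4 (- x / 2))] expresses the Catalan
   series at [x + 3 x^2] through those at [3 x / 2 = X / 4] and [- x / 2 = - X / 12],
   where [x = X / 6]. *)
Definition mu_fps : fps R :=
  2%:R^-1%:S * (3%:R * catalan_fps 4^-1 - catalan_fps (- 12^-1)
    + 6%:R * y * catalan_fps 4^-1 * catalan_fps (- 12^-1)) * geometric_fps (- 2^-1).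

Lemma fps_constZ (a b : R) (n : nat) : a = n%:R * b -> a%:S = n%:R * b%:S.
Proof. by move=> ->; rewrite rmorphM rmorph_nat. Qed.

(** With [y = X / 12], the series [1 - 6 y P] and [1 + 2 y Q] are the square roots of [1 - 12 y] and
    [1 + 4 y]. One minus their product, divided by [2 (x + 3 x^2) = 4 y (1 + 6 y)], is
    [N / (2 (1 + 6 y))], and [NE] is the resulting equation for [N]. *)
Lemma mu_fpsE : mu_fps = 1 + (x + 3%:R * x ^+ 2) * mu_fps ^+ 2.
Proof.
rewrite /mu_fps; set P := catalan_fps 4^-1; set Q := catalan_fps _.
set G := geometric_fps _; set t := 2%:R^-1%:S.
have -> : x = 2%:R * y by rewrite mulrA; congr (_ * _); apply: fps_constZ; field.
have PE : 1 + 3%:R * y * P ^+ 2 - P = 0.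
  rewrite {2}/P catalan_fpsE ?invr_eq0 ?pnatr_eq0 // -/P.
  rewrite [(4^-1)%:S](@fps_constZ _ 12%:R^-1 3); first by ring.
  by field.
have QE : 1 - y * Q ^+ 2 - Q = 0.
  rewrite {2}/Q catalan_fpsE ?oppr_eq0 ?invr_eq0 ?pnatr_eq0 // -/Q rmorphN; ring.
have GE : (1 + 6%:R * y) * G = 1.
  have := geometric_fpsE (- 2^-1); rewrite -/G (rmorphN (@fps_const R)) /=.
  have -> : (2^-1)%:S = 6%:R * 12%:R^-1%:S :> fps R by apply: fps_constZ; field.
  move=> E; transitivity (G + 6%:R * 12%:R^-1%:S * fX * G); first by ring.
  by rewrite {1}E; ring.
have tE : 2%:R * t = 1 by rewrite -(fps_constZ (a := 1)) ?rmorph1 // divff // pnatr_eq0.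
set Y := y in PE QE GE *.
set N := 3%:R * P - Q + _.
have NE : 2%:R + 12%:R * Y + Y * N ^+ 2 - N = 0.
  transitivity (3%:R * (1 + 3%:R * Y * P ^+ 2 - P) * (1 + 2%:R * Y * Q) ^+ 2 -
      (1 - 12%:R * Y) * (1 - Y * Q ^+ 2 - Q)); first by rewrite /N; ring.
  by rewrite PE QE; ring.
apply/eqP; rewrite -subr_eq0; apply/eqP.
transitivity ((2%:R * t * ((1 + 6%:R * Y) * G) - 1) * (1 - Y * G * t * N ^+ 2)
  - G * t * (2%:R + 12%:R * Y + Y * N ^+ 2 - N)); first by ring.
by rewrite NE tE GE; ring.
Qed.

Lemma sum_moves_inl (F : state -> R) k :
  \sum_(m <- moves (inl k)) F m.2 =
  \sum_(1 <= i < k.+1) F (inl i) + F (inr (k.+1, 1)) + F (inr (k.+1, 2)).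
Proof.
rewrite /moves big_cat big_map /= !big_cons big_nil /= addr0 addrA.
by rewrite /index_iota subSS subn0.
Qed.

Lemma sum_moves_inr (F : state -> R) l r :
  \sum_(m <- moves (inr (l, r))) F m.2 =
  2 * (\sum_(1 <= i < l.+1) F (inl i)) + F (inr (l.+1, 1))
  + \sum_(1 <= t < r.+1) F (inr (1, t.+1)).
Proof.
rewrite /moves !big_cat !big_map big_cons big_map /= /index_iota !subSS !subn0; ring.
Qed.

Lemma paths_fps (f : fps R) :
  let C := catalan_fps 6^-1 in
  f = 1 + mu_fps * (2%:R * (C - 1) - x) * f ->
  forall n, (paths n (inr (0, 0)))%:R / 6 ^+ n =
    (C + 2%:R * (C - 1) ^+ 2 * f * mu_fps) n.
Proof.
move=> C fE; set M := mu_fps in fE *.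
(* Solution of the linear system for the path series by the kernel method:
   from state [inl j] it is [g M^j], and from state [inr (l, r)] it is
   [c0 + z (M + ... + M^l) + p (C^r - 1)]. *)
pose z := 2%:R * (C - 1) * f; pose p := C * (1 + z * M).
pose c0 := C + (C - 1) * z * M; pose g := 1 + x * p * C * (1 + C).
have ME : M = 1 + (x + 3%:R * x ^+ 2) * M ^+ 2 by exact: mu_fpsE.
have CE : C = 1 + x * C ^+ 2 by apply: catalan_fpsE; rewrite invr_eq0 pnatr_eq0.
have xI : injective (fun u => x * u) by apply: fps_scaleX_inj; rewrite invr_eq0 pnatr_eq0.
set X := x in fE ME CE xI g *.
(* Subtracting the equations of consecutive [l] gives this relation; subtracting those of
   consecutive [j] gives [gE]. Eliminating [z] and [g] leaves [4 X^2 M^2 = (1 - X M) (M - 1 - X M)],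
   which is the equation of [M]. *)
have zE : z * (1 - X * M) = 2%:R * X * g.
  have E : z = 2%:R * (C - 1) + z * M * (2%:R * (C - 1) - X).
    by rewrite {1}/z fE /z; ring.
  have CE' : X * C ^+ 2 = C - 1 by rewrite {2}CE; ring.
  transitivity (z - X * z * M); first by ring.
  rewrite {1}E /g /p.
  transitivity (2%:R * X + 2%:R * X * (X * C ^+ 2) * (1 + C) * (1 + z * M)); last by ring.
  rewrite CE'.
  transitivity (2%:R * X + 2%:R * (X * C ^+ 2 - X) * (1 + z * M)); last by ring.
  rewrite CE'; ring.
have gE : g * (M - 1 - X * M) = 2%:R * X * z * M ^+ 2.
  apply: xI; rewrite /=.
  suff E : 2%:R * X * (g * (M - 1 - X * M)) = 2%:R * X * (2%:R * X * z * M ^+ 2).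
    apply/funext => n; have := congr1 (fun u : fps R => u n) E.
    rewrite -!mulrA -!(rmorph_nat (@fps_const R)) !fps_constM.
    by apply: mulfI; rewrite pnatr_eq0.
  transitivity (2%:R * X * g * (M - 1 - X * M)); first by ring.
  rewrite -zE.
  have ME' : M - 1 - X * M ^+ 2 - 3%:R * X ^+ 2 * M ^+ 2 = 0.
    by rewrite {1}ME; ring.
  transitivity (z * (M - 1 - X * M ^+ 2 - 3%:R * X ^+ 2 * M ^+ 2)
    + 4%:R * X ^+ 2 * z * M ^+ 2); first by ring.
  by rewrite ME'; ring.
pose A j := g * M ^+ j.
pose Pl l := c0 + z * M * \sum_(i < l) M ^+ i.
pose B l r := Pl l + p * (C ^+ r - 1).
have PlS l : Pl l.+1 = Pl l + z * M ^+ l.+1.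
  by rewrite /Pl big_ord_recr /= exprS; ring.
have CE' : X * C ^+ 2 = C - 1 by rewrite {2}CE; ring.
have c0E : c0 = 1 + X * p * C.
  transitivity (1 + X * C ^+ 2 * (1 + z * M)); last by rewrite /p; ring.
  by rewrite CE' /c0; ring.
have P1 : Pl 1%N = p.
  by rewrite /Pl big_ord_recr big_ord0 /= add0r expr0 /c0 /p; ring.
have AE j : A j = 1 + X * (\sum_(1 <= i < j.+1) A i + B j.+1 1%N + B j.+1 2).
  elim: j => [|j IHj].
    by rewrite big_geq // /A /B P1 expr0 /g; ring.
  rewrite big_nat_recr //=.
  transitivity (A j + A j * (M - 1)); first by rewrite /A exprS; ring.
  rewrite {1}IHj /B !PlS.
  have E : A j * (M - 1) = X * (A j.+1 + 2%:R * z * M ^+ j.+2).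
    transitivity (X * A j * M + M ^+ j * (g * (M - 1 - X * M))); first by rewrite /A; ring.
    by rewrite gE /A !exprS; ring.
  rewrite E /A !exprS; ring.
have BE l r : B l r = 1 + X * (2%:R * (\sum_(1 <= i < l.+1) A i) + B l.+1 1%N
    + \sum_(1 <= t < r.+1) B 1%N t.+1).
  elim: l => [|l IHl].
    elim: r => [|r IHr].
      rewrite !big_geq // /B P1 /Pl big_ord0 c0E; ring.
    rewrite (big_nat_recr r.+1) //=.
    transitivity (B 0%N r + p * C ^+ r * (C - 1)); first by rewrite /B exprS; ring.
    rewrite -[X in _ + _ * X = _]CE' IHr /B P1 !exprS; ring.
  rewrite (big_nat_recr l.+1) //=.
  transitivity (B l r + z * M ^+ l.+1); first by rewrite /B PlS; ring.
  have E : z * M ^+ l.+1 = X * (2%:R * A l.+1 + z * M ^+ l.+2).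
    transitivity (X * z * M ^+ l.+2 + M ^+ l.+1 * (z * (1 - X * M))).
      by rewrite [M ^+ l.+2]exprS; ring.
    by rewrite zE /A; ring.
  rewrite IHl E /B (PlS l.+1); ring.
have BC : B 0%N 0%N = C + 2%:R * (C - 1) ^+ 2 * f * M.
  by rewrite /B /Pl big_ord0 /c0 /z expr0; ring.
clearbody A B.
have X0 u : (1 + X * u) 0%N = 1 by rewrite fpsD fps1 /X -mulrA fps_constM fpsXM mulr0 addr0.
have XS u k : (1 + X * u) k.+1 = 6^-1 * u k.
  by rewrite fpsD fps1 /X -mulrA fps_constM fpsXM add0r.
have E6 k : (6 ^+ k.+1 : R)^-1 = 6^-1 * (6 ^+ k)^-1 by rewrite exprS invfM.
have E2 (u : fps R) k : (2%:R * u) k = 2 * u k.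
  by rewrite -(rmorph_nat (@fps_const R)) fps_constM.
have H k : (forall j, (paths k (inl j))%:R / 6 ^+ k = A j k) /\
           (forall l r, (paths k (inr (l, r)))%:R / 6 ^+ k = B l r k).
  elim: k => [|k [IHA IHB]].
    by split=> [j|l r]; [rewrite AE X0 | rewrite BE X0]; rewrite expr0 divr1.
  split=> [j|l r]; rewrite [paths _ _]/= natr_sum.
    rewrite (sum_moves_inl (fun s => (paths k s)%:R)) AE XS E6 mulrCA; congr (_ * _).
    rewrite !mulrDl mulr_suml !IHB !fpsD fps_sum; congr (_ + _ + _).
    by apply: eq_bigr => i _; exact: IHA.
  rewrite (sum_moves_inr (fun s => (paths k s)%:R)) BE XS E6 mulrCA; congr (_ * _).
  rewrite 2!mulrDl -mulrA !mulr_suml IHB fpsD fpsD E2 !fps_sum.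
  congr (_ * _ + _ + _); first by apply: eq_bigr => i _; exact: IHA.
  by apply: eq_bigr => t _; exact: IHB.
by move=> n; rewrite (H n).2 BC.
Qed.
End PathSeries.

(** * Limits of sums *)

Section Tannery.
Variable R : realType.
Implicit Types (u v A M : nat -> R) (a : nat -> nat -> R).

Lemma cvgn_unique u (l l' : R) : u @ \oo --> l -> u @ \oo --> l' -> l = l'.
Proof. by move=> /cvg_lim <- // /cvg_lim <-. Qed.

Lemma cvgn_le_const u (l B : R) : u @ \oo --> l -> (forall n, u n <= B) -> l <= B.
Proof.
move=> ul uB; rewrite -(cvg_lim _ ul) //; apply: limr_le; first by apply/cvg_ex; exists l.
by near=> n; exact: uB.
Unshelve. all: by end_near. Qed.

Lemma cvgn_ge_const u (l B : R) : u @ \oo --> l -> (forall n, B <= u n) -> B <= l.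
Proof.
move=> ul uB; rewrite -(cvg_lim _ ul) //; apply: limr_ge; first by apply/cvg_ex; exists l.
by near=> n; exact: uB.
Unshelve. all: by end_near. Qed.

Lemma cvgn_bounded u (l : R) : u @ \oo --> l -> exists2 B, 0 < B & forall n, `|u n| <= B.
Proof.
move=> ul; have /cvg_seq_bounded[B [Br HB]] : cvgn u by apply/cvg_ex; exists l.
exists (Num.max 1 (B + 1)); first by rewrite lt_max ltr01.
by move=> n; apply: HB => //; rewrite lt_max ltrDl ltr01 orbT.
Qed.

Lemma nneg_series_cvg u (B : R) : (forall n, 0 <= u n) ->
  (forall n, series u n <= B) -> cvgn (series u).
Proof.
move=> u0 uB; apply: nondecreasing_is_cvgn.
  by apply: nondecreasing_series => n _ _; exact: u0.
by exists B => _ [n _ <-].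
Qed.

Lemma nneg_series_le_lim u (l : R) n : (forall n, 0 <= u n) ->
  series u @ \oo --> l -> series u n <= l.
Proof.
move=> u0 ul; rewrite -(cvg_lim _ ul) //; apply: nondecreasing_cvgn_le.
  by apply: nondecreasing_series => m _ _; exact: u0.
by apply/cvg_ex; exists l.
Qed.

Lemma le_norm_series_cvg u M : (forall n, `|u n| <= M n) -> cvgn (series M) ->
  cvgn (series (fun n => `|u n|)).
Proof.
move=> uM; apply: series_le_cvg => // n; exact: le_trans (uM n).
Qed.

Lemma cvgn_sum_ord a A K : (forall k, (fun n => a n k) @ \oo --> A k) ->
  (fun n => \sum_(k < K) a n k) @ \oo --> \sum_(k < K) A k.
Proof.
move=> aA; elim: K => [|K IHK].
  by rewrite big_ord0; under eq_fun do rewrite big_ord0; exact: cvg_cst.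
rewrite big_ord_recr; under eq_fun do rewrite big_ord_recr.
exact: cvgD.
Qed.

(** The terms beyond a fixed index are bounded by the tail of [M] uniformly in [n]; what remains is
    a finite sum of limits. *)
Lemma tannery a A M : (forall k, (fun n => a n k) @ \oo --> A k) ->
  (forall n k, `|a n k| <= M k) -> cvgn (series M) ->
  (fun n => \sum_(k < n.+1) a n k) @ \oo --> limn (series A).
Proof.
move=> aA aM Mcv.
have M0 k : 0 <= M k by exact: le_trans (aM 0%N k).
have AM k : `|A k| <= M k.
  by apply: (cvgn_le_const (cvg_norm (aA k))) => n; exact: aM.
have /cvg_ex[/= S AS] : cvgn (series A).
  by apply: normed_cvg; exact: le_norm_series_cvg AM Mcv.
rewrite (cvg_lim _ AS) //.
have /cvg_ex[/= T MT] := Mcv.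
have tail u (uM : forall k, `|u k| <= M k) K n : (K <= n)%N ->
    `|\sum_(k < n) u k - \sum_(k < K) u k| <= T - series M K.
  move=> Kn; apply: (@le_trans _ _ (series M n - series M K)); last first.
    by rewrite lerB //; exact: nneg_series_le_lim.
  have subE (w : nat -> R) :
      \sum_(k < n) w k - \sum_(k < K) w k = \sum_(K <= k < n) w k.
    by rewrite -!(big_mkord xpredT w) (big_cat_nat (n := K) (p := n)) //= addrAC subrr add0r.
  rewrite /series /= !big_mkord !subE.
  by apply: le_trans (ler_norm_sum _ _ _) _; apply: ler_sum.
apply/cvgrPdist_le => e e0; have e4 : 0 < e / 4 by rewrite divr_gt0.
have /cvgrPdist_le/(_ _ e4)[N _ HN] := MT.
have TN : T - series M N <= e / 4.
  by apply: le_trans (ler_norm _) (HN N _); rewrite /= leqnn.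
have AN : `|S - \sum_(k < N) A k| <= e / 4.
  apply: (@le_trans _ _ (T - series M N)) => //.
  have Acv : (fun n => `|series A n - \sum_(k < N) A k|) @ \oo --> `|S - \sum_(k < N) A k|.
    by apply: cvg_norm; apply: cvgB => //; exact: cvg_cst.
  rewrite -(cvg_lim _ Acv) //; apply: limr_le; first by apply/cvg_ex; eexists; exact: Acv.
  by near=> n; rewrite /series /= big_mkord; apply: tail => //; near: n; exact: nbhs_infty_ge.
have /cvgrPdist_le/(_ _ e4) near_a := cvgn_sum_ord (K := N) aA.
near=> n.
have Nn : (N <= n.+1)%N by near: n; exists N => // m /= Nm; rewrite (leq_trans Nm).
have -> : S - \sum_(k < n.+1) a n k =
    (S - \sum_(k < N) A k) + (\sum_(k < N) A k - \sum_(k < N) a n k)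
    - (\sum_(k < n.+1) a n k - \sum_(k < N) a n k) by ring.
have H1 : `|\sum_(k < N) A k - \sum_(k < N) a n k| <= e / 4 by near: n.
have H2 : `|\sum_(k < n.+1) a n k - \sum_(k < N) a n k| <= e / 4.
  by apply: le_trans (tail (a n) (aM n) _ _ Nn) TN.
apply: le_trans (ler_normB _ _) _.
apply: (@le_trans _ _ (e / 4 + e / 4 + e / 4)); last by lra.
by rewrite lerD // (le_trans (ler_normD _ _)) // lerD.
Unshelve. all: by end_near. Qed.

Lemma series_recr u n : series u n.+1 = series u n + u n.
Proof. by rewrite /series /= big_nat_recr. Qed.

Lemma series_fpsM (u v : fps R) n :
  series (u * v : fps R) n = \sum_(k < n) u k * series v (n - k)%N.
Proof.
elim: n => [|n IHn]; first by rewrite /series /= big_geq // big_ord0.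
rewrite series_recr IHn fpsM.
rewrite big_ord_recr [RHS]big_ord_recr /= subnn subSnn addrA -big_split; congr (_ + _); last first.
  by rewrite /series /= big_nat1.
apply: eq_bigr => k _; rewrite subSn; last by rewrite ltnW.
by rewrite series_recr mulrDr.
Qed.

(** Mertens' theorem: the partial sums of the product are a convolution of [u] with the bounded
    partial sums of [v]. *)
Lemma series_fpsM_cvg (u v : fps R) (s t : R) : cvgn (series (fun n => `|u n|)) ->
  series u @ \oo --> s -> series v @ \oo --> t -> series (u * v : fps R) @ \oo --> s * t.
Proof.
move=> ucv us vt; rewrite -(cvg_shiftS _).
under eq_fun do rewrite series_fpsM.
have [B B0 HB] := cvgn_bounded vt.
have -> : s * t = limn (series (fun k => u k * t)).
  apply/esym/cvg_lim => //; rewrite (_ : series _ = fun n => series u n * t).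
    by apply: cvgM => //; exact: cvg_cst.
  by apply/funext => n; rewrite /series /= mulr_suml.
apply: (@tannery (fun n k => u k * series v (n.+1 - k)%N) _ (fun k => `|u k| * B)).
- move=> k; apply: cvgM; first exact: cvg_cst.
  rewrite -(cvg_shiftn k); under eq_fun do rewrite /= -addSn addnK.
  by move: vt; rewrite -(cvg_shiftS (series v)).
- by move=> n k; rewrite normrM ler_wpM2l.
- have /cvg_ex[/= S US] := ucv; apply/cvg_ex; exists (S * B).
  rewrite (_ : series _ = fun n => series (fun k => `|u k|) n * B).
    by apply: cvgM => //; exact: cvg_cst.
  by apply/funext => n; rewrite /series /= mulr_suml.
Qed.

End Tannery.

(** * The reference sequence *)

Section Asymptotics.
Variable R : realType.
Implicit Types (u v : fps R) (k s B : R).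
Local Notation p := (catalan_fps (4^-1 : R)).
Local Notation "c %:S" := (fps_const c) (at level 1, format "c %:S").

Lemma catalan_gt0 n : 0 < catalan R n.
Proof. by elim: n => //= n IHn; rewrite mulr_gt0 // divr_gt0 // ltr0n. Qed.

Lemma cat4_gt0 n : 0 < p n.
Proof. by rewrite mulr_gt0 ?catalan_gt0 // exprn_gt0. Qed.

Lemma cat4_neq0 n : p n != 0. Proof. by rewrite gt_eqF ?cat4_gt0. Qed.

Lemma cat4S n : p n.+1 = (2 * n%:R + 1) / (2 * n%:R + 4) * p n.
Proof.
rewrite /catalan_fps /= exprS; field.
by have x0 := ler0n R n; apply/andP; split; rewrite gt_eqF //; lra.
Qed.

(** The exponent 2 exceeds the true order 3/2 of decay and keeps everything rational; the step
    reduces to [x (x + 2) >= 0]. *)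
Lemma cat4_quadratic_mono m n : (m <= n)%N -> p m * m.+1%:R ^+ 2 <= p n * n.+1%:R ^+ 2.
Proof.
elim: n => [|n IHn]; first by rewrite leqn0 => /eqP->.
rewrite leq_eqVlt => /orP[/eqP->//|]; rewrite ltnS => /IHn/le_trans; apply.
set x : R := n%:R; have x0 : 0 <= x by rewrite ler0n.
have -> : n.+2%:R = x + 2 :> R by rewrite -addn2 natrD.
have -> : n.+1%:R = x + 1 :> R by rewrite -addn1 natrD.
rewrite cat4S -/x.
have d0 : 0 < 2 * x + 4 by lra.
have -> : (2 * x + 1) / (2 * x + 4) * p n * (x + 2) ^+ 2 =
          p n * ((2 * x + 1) * (x + 2) ^+ 2 / (2 * x + 4)).
  by field; rewrite gt_eqF //; lra.
rewrite ler_pM2l ?cat4_gt0 // ler_pdivlMr // -subr_ge0.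
have -> : (2 * x + 1) * (x + 2) ^+ 2 - (x + 1) ^+ 2 * (2 * x + 4) = x * (x + 2) by ring.
by rewrite mulr_ge0 ?addr_ge0.
Qed.

(** Here [n + 1 <= 2 (m + 1)], so the quadratic monotonicity loses at most [2^2]. *)
Lemma cat4_le_double m n : (m <= n)%N -> (n <= m.*2.+1)%N -> p m <= 4 * p n.
Proof.
move=> mn nm; have := cat4_quadratic_mono mn.
have h : n.+1%:R <= 2 * m.+1%:R :> R by rewrite -natrM ler_nat -addnn in nm *; lia.
have h0 : 0 < m.+1%:R :> R by rewrite ltr0n.
have := cat4_gt0 n; have := cat4_gt0 m.
move: (n.+1%:R : R) (m.+1%:R : R) h h0 (ler0n R n.+1) => x y xy y0 x0 p1 p2 H.
have : p m * y ^+ 2 <= (4 * p n) * y ^+ 2.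
  apply: le_trans H _; rewrite [4 * _]mulrC -[leRHS]mulrA ler_pM2l //.
  have : x ^+ 2 <= (2 * y) ^+ 2.
    by rewrite ler_sqr ?nnegrE //; nra.
  by rewrite exprMn (_ : 2 ^+ 2 = 4) //; ring.
by rewrite ler_pM2r // exprn_gt0.
Qed.

Lemma cat4_shift m : (fun n => p n / p (n + m)%N) @ \oo --> (1 : R).
Proof.
elim: m => [|m IHm].
  under eq_fun do rewrite addn0 divff ?cat4_neq0 //.
  exact: cvg_cst.
(* This is the ratio [p n / p (n + 1) = (2 n + 4) / (2 n + 1)]. *)
have H : (fun n => 1 + 3 / 2 * (n%:R + 2^-1)^-1) @ \oo --> (1 : R).
  rewrite -[X in _ --> X]addr0 -[X in _ + X](mulr0 (3 / 2)).
  apply: cvgD; first exact: cvg_cst.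
  apply: cvgM; first exact: cvg_cst.
  apply: (@squeeze_cvgr _ _ _ _ (fun=> 0) (fun n => 2 * (n.+1%:R)^-1)).
  - near=> n; have x0 := ler0n R n; have y0 : 0 < (n%:R + 1) / 2 :> R by lra.
    have -> : 2 * n.+1%:R^-1 = ((n%:R + 1) / 2)^-1 :> R.
      by rewrite -addn1 natrD; field; rewrite gt_eqF //; lra.
    apply/andP; split; first by rewrite invr_ge0; lra.
    by rewrite lef_pV2 ?posrE //; lra.
  - exact: cvg_cst.
  - rewrite -[X in _ --> X](mulr0 2); apply: cvgM; first exact: cvg_cst.
    exact: cvg_harmonic.
have : (fun n => p n / p (n + m)%N * (1 + 3 / 2 * ((n + m)%:R + 2^-1)^-1)) @ \oo --> (1 : R).
  rewrite -[X in _ --> X]mulr1; apply: cvgM => //.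
  by rewrite -(cvg_shiftn m) in H.
apply: cvg_trans; apply: near_eq_cvg; near=> n.
rewrite addnS cat4S; have := cat4_neq0 (n + m)%N; set x : R := (n + m)%:R => pn; field.
have x0 : 0 <= x by rewrite ler0n.
by do ?[apply/andP; split] => //; rewrite gt_eqF //; lra.
Unshelve. all: by end_near. Qed.
End Asymptotics.

(** * Coefficient asymptotics *)

Section AsymptoticClass.
Variable R : realType.
Implicit Types (u v : fps R) (s B : R) (n k : nat).
Local Notation p := (catalan_fps (4^-1 : R)).
Local Notation "c %:S" := (fps_const c) (at level 1, format "c %:S").

(* [p n] is asymptotic to a multiple of [n^(-3/2)] and serves as reference
   sequence because its ratios and partial sums are rational. *)
Definition asy u (l s : R) : Prop :=
  (fun n => u n / p n) @ \oo --> l /\ series u @ \oo --> s.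

Definition dominated u B : Prop := forall n, `|u n| <= B * p n.

Lemma series_cat4 n : series p n = 2 - 2 * n.+1%:R * p n.
Proof.
elim: n => [|n IHn].
  by rewrite /series /= big_geq // /catalan_fps expr0 /=; ring.
rewrite series_recr IHn cat4S; have x0 := ler0n R n.
have -> : n.+2%:R = n%:R + 2 :> R by rewrite -addn2 natrD.
have -> : n.+1%:R = n%:R + 1 :> R by rewrite -addn1 natrD.
by field; rewrite gt_eqF //; lra.
Qed.

Lemma series_cat4_le2 n : series p n <= 2.
Proof. by rewrite series_cat4 gerBl mulr_ge0 // (ltW (cat4_gt0 R n)). Qed.

Lemma cvg_series_cat4 : cvgn (series p).
Proof.
by apply: (@nneg_series_cvg _ _ 2) => n; [exact/ltW/cat4_gt0 | exact: series_cat4_le2].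
Qed.

Lemma dominated_abs_cvg u B : dominated u B -> cvgn (series (fun n => `|u n|)).
Proof.
move=> uB; apply: (le_norm_series_cvg uB); have /cvg_ex[/= S HS] := cvg_series_cat4.
apply/cvg_ex; exists (B * S).
rewrite (_ : series _ = fun n => B * series p n); first by apply: cvgM => //; exact: cvg_cst.
by apply/funext => n; rewrite /series /= mulr_sumr.
Qed.

Lemma dominated_series_cvg u B : dominated u B -> cvgn (series u).
Proof. by move=> uB; apply: normed_cvg; exact: dominated_abs_cvg uB. Qed.

Lemma ratio_dominated u (l : R) : (fun n => u n / p n) @ \oo --> l ->
  exists2 B, 0 < B & dominated u B.
Proof.
move=> ul; have [B B0 HB] := cvgn_bounded ul; exists B => // n.
have := HB n; rewrite normrM normfV (gtr0_norm (cat4_gt0 R n)).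
by rewrite ler_pdivrMr // cat4_gt0.
Qed.

Lemma ratio_asy u (l : R) : (fun n => u n / p n) @ \oo --> l ->
  exists s, asy u l s.
Proof.
move=> ul; have [B' _ /dominated_series_cvg/cvg_ex[s us]] := ratio_dominated ul.
by exists s.
Qed.

Lemma asy_dominated u (l s : R) : asy u l s -> exists2 B, 0 < B & dominated u B.
Proof. by case=> /ratio_dominated. Qed.

Lemma asy_sum_unique u (l l' s s' : R) : asy u l s -> asy u l' s' -> s = s'.
Proof. by move=> [_ us] [_ us']; exact: cvgn_unique us us'. Qed.

Lemma ratio_shift u (l : R) k : (fun n => u n / p n) @ \oo --> l ->
  (fun n => u (n - k)%N / p n) @ \oo --> l.
Proof.
move=> ul; rewrite -(cvg_shiftn k).
rewrite (_ : [sequence _]_n = fun n => u n / p n * (p n / p (n + k)%N)).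
  by rewrite -(mulr1 l); apply: cvgM => //; exact: cat4_shift.
apply/funext => n /=; rewrite addnK; have := cat4_neq0 R n; have := cat4_neq0 R (n + k).
move: (p n) (p (n + k)%N) => a b a0 b0; field.
by rewrite a0 b0.
Qed.

(** Cutting at [k <= n / 2] keeps [n - k] of order [n], so [v (n - k)] is at most a constant times
    [p n] and [tannery] applies. The weight [c] serves both for plain indicators and for the factors
    [k / n] and [(n - k) / n] of the renewal argument. *)
Lemma half_convolution_cvg u v B (c : nat -> nat -> R) (l : nat -> R) :
  cvgn (series (fun n => `|u n|)) -> dominated v B ->
  (forall n k, `|c n k| <= 1) -> (forall n k, (n < k.*2)%N -> c n k = 0) ->
  (forall k, (fun n => c n k * (v (n - k)%N / p n)) @ \oo --> l k) ->
  (fun n => (\sum_(k < n.+1) c n k * (u k * v (n - k)%N)) / p n) @ \oo -->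
    limn (series (fun k => u k * l k)).
Proof.
move=> ucv vB c1 c0 cl.
rewrite (_ : (fun n => _) =
    fun n => \sum_(k < n.+1) u k * (c n k * (v (n - k)%N / p n))); last first.
  by apply/funext => n; rewrite mulr_suml; apply: eq_bigr => k _; ring.
apply: (@tannery _ (fun n k => u k * (c n k * (v (n - k)%N / p n))) _
  (fun k => `|u k| * (4 * B))).
- by move=> k; apply: cvgM => //; exact: cvg_cst.
- move=> n k; rewrite normrM ler_wpM2l //.
  have B0 : 0 <= B.
    by have := le_trans (normr_ge0 _) (vB 0%N); rewrite pmulr_lge0 // cat4_gt0.
  have [kn|nk] := leqP k.*2 n; last by rewrite c0 // mul0r normr0 mulr_ge0.
  rewrite normrM; apply: (@le_trans _ _ (1 * `|v (n - k)%N / p n|)).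
    by rewrite ler_wpM2r.
  rewrite mul1r normrM normfV (gtr0_norm (cat4_gt0 R n)) ler_pdivrMr ?cat4_gt0 //.
  apply: le_trans (vB _) _.
  have -> : 4 * B * p n = B * (4 * p n) by ring.
  rewrite ler_wpM2l //.
  by apply: cat4_le_double; rewrite -?addnn in kn *; lia.
- have /cvg_ex[/= S HS] := ucv; apply/cvg_ex; exists (S * (4 * B)).
  rewrite (_ : series _ = fun n => series (fun k => `|u k|) n * (4 * B)).
    by apply: cvgM => //; exact: cvg_cst.
  by apply/funext => n; rewrite /series /= mulr_suml.
Qed.

(** The terms with [k > n / 2] are reindexed by [n - k]; a middle term goes to the first sum, hence
    one weak and one strict inequality. *)
Lemma convolution_halves (w : nat -> R) u v n :
  \sum_(k < n.+1) w k * (u k * v (n - k)%N) =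
  \sum_(k < n.+1) (w k * (k.*2 <= n)%:R) * (u k * v (n - k)%N) +
  \sum_(k < n.+1) (w (n - k)%N * (k.*2 < n)%:R) * (v k * u (n - k)%N).
Proof.
rewrite [X in _ = _ + X](reindex_inj rev_ord_inj) -big_split /=; apply: eq_bigr => k _.
have kn : (k <= n)%N by rewrite -ltnS.
rewrite subSS subKn //.
have -> : ((n - k).*2 < n)%N = ~~ (k.*2 <= n)%N by rewrite -!addnn; lia.
by case: leqP => _ /=; ring.
Qed.

Lemma cvg_half_indicator k : (fun n => (k.*2 <= n)%:R : R) @ \oo --> (1 : R).
Proof.
apply: cvg_near_cst; near=> n.
have -> // : (k.*2 <= n)%N by near: n; exact: nbhs_infty_ge.
Unshelve. all: by end_near. Qed.

Lemma cvg_half_indicator_lt k : (fun n => (k.*2 < n)%:R : R) @ \oo --> (1 : R).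
Proof.
apply: cvg_near_cst; near=> n.
have -> // : (k.*2 < n)%N by near: n; exact: nbhs_infty_gt.
Unshelve. all: by end_near. Qed.

Lemma lim_series_mulr (u : nat -> R) (l s : R) : series u @ \oo --> s ->
  limn (series (fun k => u k * l)) = s * l.
Proof.
move=> us; apply: cvg_lim => //.
rewrite (_ : series _ = fun n => series u n * l).
  by apply: cvgM => //; exact: cvg_cst.
by apply/funext => n; rewrite /series /= mulr_suml.
Qed.

Lemma norm_natb (b : bool) : `|b%:R| <= 1 :> R.
Proof. by case: b; rewrite ?normr1 ?normr0. Qed.

(** The convolution is carried by its two ends, where one index stays bounded: each end contributes
    the sum of one factor times the ratio limit of the other. *)
Lemma asyM u v (l l' s s' : R) : asy u l s -> asy v l' s' ->
  asy (u * v : fps R) (s * l' + s' * l) (s * s').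
Proof.
move=> Hu Hv; have [ul us] := Hu; have [vl vs] := Hv.
have [Bu _ uB] := asy_dominated Hu; have [Bv _ vB] := asy_dominated Hv.
split; last exact: series_fpsM_cvg (dominated_abs_cvg uB) us vs.
have -> : (fun n => (u * v : fps R) n / p n) = fun n =>
    (\sum_(k < n.+1) (k.*2 <= n)%:R * (u k * v (n - k)%N)) / p n +
    (\sum_(k < n.+1) (k.*2 < n)%:R * (v k * u (n - k)%N)) / p n.
  apply/funext => n; rewrite -mulrDl fpsM; congr (_ / _).
  have := convolution_halves (fun=> 1) u v n.
  under eq_bigr do rewrite mul1r; move=> ->; congr (_ + _);
    by apply: eq_bigr => k _; rewrite mul1r.
rewrite -(lim_series_mulr l' us) -(lim_series_mulr l vs); apply: cvgD.
- apply: (@half_convolution_cvg u v Bv (fun n k => (k.*2 <= n)%:R) (fun=> l')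
    (dominated_abs_cvg uB) vB) => [n k|n k nk|k].
  + exact: norm_natb.
  + by rewrite leqNgt nk.
  + rewrite /= -(mul1r l'); apply: cvgM; first exact: cvg_half_indicator.
    exact: ratio_shift.
- apply: (@half_convolution_cvg v u Bu (fun n k => (k.*2 < n)%:R) (fun=> l)
    (dominated_abs_cvg vB) uB) => [n k|n k nk|k].
  + exact: norm_natb.
  + by rewrite ltnNge ltnW.
  + rewrite /= -(mul1r l); apply: cvgM; first exact: cvg_half_indicator_lt.
    exact: ratio_shift.
Qed.

Lemma asyD u v (l l' s s' : R) : asy u l s -> asy v l' s' ->
  asy (u + v : fps R) (l + l') (s + s').
Proof.
move=> [ul us] [vl vs]; split.
  rewrite (_ : (fun n => _) = fun n => u n / p n + v n / p n); first exact: cvgD.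
  by apply/funext => n; rewrite -mulrDl.
rewrite (_ : series _ = fun n => series u n + series v n); first exact: cvgD.
by apply/funext => n; rewrite /series /= -big_split.
Qed.

Lemma asy_finite u N : (forall n, (N <= n)%N -> u n = 0) ->
  asy u 0 (\sum_(k < N) u k).
Proof.
move=> u0; split; apply: cvg_near_cst; near=> n.
  by rewrite u0 ?mul0r //; near: n; exact: nbhs_infty_ge.
have Nn : (N <= n)%N by near: n; exact: nbhs_infty_ge.
rewrite /series /= (big_cat_nat (n := N)) //= [X in _ + X]big_nat_cond.
by rewrite [X in _ + X]big1 ?addr0 ?big_mkord // => i /andP[/andP[Ni _] _]; rewrite u0.
Unshelve. all: by end_near. Qed.

Lemma asy_const (a : R) : asy (a%:S) 0 a.
Proof.
have -> : a = \sum_(k < 1) (a%:S : fps R) k by rewrite big_ord1.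
by rewrite {1}big_ord1; apply: asy_finite => -[|n].
Qed.

Lemma asy_X : asy (fpsX R) 0 1.
Proof.
have -> : (1 : R) = \sum_(k < 2) fpsX R k by rewrite !big_ord_recr big_ord0 /= /fpsX !add0r.
by apply: asy_finite => -[|[|n]].
Qed.

Lemma asyZ (a : R) u (l s : R) : asy u l s -> asy (a%:S * u) (a * l) (a * s).
Proof.
move=> /(asyM (asy_const a)); rewrite mulr0 addr0; exact.
Qed.

Lemma asyN u (l s : R) : asy u l s -> asy (- u : fps R) (- l) (- s).
Proof.
by move=> /(asyZ (- 1)); rewrite !mulN1r rmorphN rmorph1 mulN1r.
Qed.

End AsymptoticClass.

(** * Renewal equations *)

Section Renewal.
Variable R : realType.
Implicit Types (u v : fps R) (n k : nat).
Local Notation p := (catalan_fps (4^-1 : R)).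

Variables (K f : fps R) (kappa s : R).
Hypotheses (K_ge0 : forall n, 0 <= K n) (K0 : K 0%N = 0).
Hypotheses (asyK : asy K kappa s) (s1 : s < 1) (fE : f = 1 + K * f).

Lemma renewal_ge0 n : 0 <= f n.
Proof.
elim/ltn_ind: n => n IHn; rewrite fE fpsD fps1 fpsM addr_ge0 //.
apply: sumr_ge0 => -[[|k] /= kn] _; first by rewrite K0 mul0r.
by rewrite mulr_ge0 // IHn //; lia.
Qed.

Lemma renewal_sum_ge0 : 0 <= s.
Proof. by apply: (cvgn_ge_const asyK.2) => n; apply: sumr_ge0. Qed.

(** By nonnegativity each partial sum [F] satisfies [F <= 1 + s F]. *)
Lemma renewal_series_le n : series f n <= (1 - s)^-1.
Proof.
have Smono m m' : (m <= m')%N -> series f m <= series f m'.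
  by apply: nondecreasing_series => k _ _; exact: renewal_ge0.
have S0 m : 0 <= series f m by apply: sumr_ge0 => k _; exact: renewal_ge0.
rewrite -div1r ler_pdivlMr ?subr_gt0 // mulrBr mulr1 lerBlDr.
have fS : series f n = series (1 : fps R) n + series (K * f : fps R) n.
  by rewrite {1}fE /series /= -big_split.
rewrite [leLHS]fS {fS}.
apply: lerD.
  case: n => [|n]; first by rewrite /series /= big_geq.
  rewrite /series /= big_nat_recl // big1 ?addr0 //.
rewrite series_fpsM; apply: (@le_trans _ _ (\sum_(k < n) K k * series f n)).
  by apply: ler_sum => k _; rewrite ler_wpM2l // Smono // leq_subr.
rewrite -mulr_suml -(big_mkord xpredT K) [leRHS]mulrC; apply: ler_wpM2r => //.
exact: (nneg_series_le_lim _ K_ge0 asyK.2).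
Qed.

Lemma renewal_sum : series f @ \oo --> (1 - s)^-1.
Proof.
have /cvg_ex[/= F fF] : cvgn (series f).
  exact: nneg_series_cvg renewal_ge0 renewal_series_le.
have [B _ KB] := asy_dominated asyK.
have H := series_fpsM_cvg (dominated_abs_cvg KB) asyK.2 fF.
have E : F = 1 + s * F.
  apply: (cvgn_unique fF); rewrite (_ : series f =
    fun n => series (1 : fps R) n + series (K * f : fps R) n).
    by apply: cvgD => //; exact: (asy_const 1).2.
  by apply/funext => n; rewrite {1}fE /series /= -big_split.
suff <- : F = (1 - s)^-1 by [].
have s1' : 1 - s != 0 by rewrite subr_eq0 eq_sym lt_eqF.
by apply: (mulIf s1'); rewrite mulVf // mulrBr mulr1 {1}E; ring.
Qed.

(* [1 / p] is subadditive up to constants, because [n ^ 2 * p n] is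
   nondecreasing; taking [d] small makes the second constant close to 1. *)
Lemma inv_cat4_add (d : R) k n : 0 < d -> (k <= n)%N ->
  (p n)^-1 <= (1 + d^-1) ^+ 2 / p k + (1 + d) ^+ 2 / p (n - k)%N.
Proof.
move=> d0 kn.
have key j (a : R) : (j <= n)%N -> 0 <= a -> n.+1%:R <= a * j.+1%:R ->
    (p n)^-1 <= a ^+ 2 / p j.
  move=> jn a0 na; have := cat4_quadratic_mono R jn.
  have j0 : 0 < j.+1%:R :> R by rewrite ltr0n.
  have pj := cat4_gt0 R j; have pn := cat4_gt0 R n.
  move: (p j) (p n) pj pn (j.+1%:R : R) (n.+1%:R : R) (ler0n R n.+1) j0 na.
  move=> q r q0 r0 y x x0 y0 xy H.
  rewrite ler_pdivlMr // mulrC ler_pdivrMr //.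
  have : q * y ^+ 2 <= a ^+ 2 * r * y ^+ 2.
    apply: le_trans H _.
    have -> : a ^+ 2 * r * y ^+ 2 = r * (a * y) ^+ 2 by ring.
    rewrite ler_pM2l //.
    by rewrite ler_sqr ?nnegrE // mulr_ge0 // ltW.
  by rewrite ler_pM2r // exprn_gt0.
(* As [n + 1 = k + (n - k + 1)], in the first case it is at most [(1 + d) (n - k + 1)], in the
   second at most [(1 + 1/d) (k + 1)]. *)
have [h|h] := lerP k%:R (d * (n - k).+1%:R).
  apply: ler_wpDl; first by rewrite divr_ge0 ?sqr_ge0 // ltW // cat4_gt0.
  apply: key; [exact: leq_subr | by rewrite addr_ge0 // ltW |].
  by rewrite -subSn // in h *; rewrite natrB ?(leqW kn) // in h *; lra.
apply: ler_wpDr; first by rewrite divr_ge0 ?sqr_ge0 // ltW // cat4_gt0.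
apply: key => //; first by rewrite addr_ge0 // invr_ge0 ltW.
have : (n - k).+1%:R <= d^-1 * k%:R by rewrite mulrC ler_pdivlMr // mulrC ltW.
rewrite -subSn // natrB ?(leqW kn) // => h'.
have : 0 < d^-1 by rewrite invr_gt0.
by rewrite -[k.+1]addn1 natrD => ?; lra.
Qed.

(** Strong induction on [f n <= D p n]. Splitting [1 / p n] by [inv_cat4_add], the part with
    [1 / p k] costs a constant [C] independent of [D], and the part with [1 / p (n - k)] costs
    [th * D]. Since [th < 1], a large [D] closes the induction. *)
Lemma renewal_dominated : exists B, dominated f B.
Proof.
have [B B0 KB] := asy_dominated asyK.
(* For this [d], [th <= (1 + 3 d) s] and [1 - (1 + 3 d) s = (1 - s) (1 - 3 s / 4) > 0]. *)
pose d := (1 - s) / 4; have s0 := renewal_sum_ge0; have s1' := s1.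
have d0 : 0 < d by rewrite divr_gt0 // subr_gt0.
pose th := (1 + d) ^+ 2 * s.
have th1 : 0 < 1 - th.
  have d1 : d <= 1 by rewrite /d; lra.
  have h : (1 + d) ^+ 2 <= 1 + 3 * d.
    have -> : (1 + d) ^+ 2 = 1 + 2 * d + d * d by ring.
    have : d * d <= d * 1 by rewrite ler_wpM2l // ltW.
    by lra.
  have h' : th <= (1 + 3 * d) * s by rewrite /th ler_wpM2r.
  have : 1 - (1 + 3 * d) * s = (1 - s) * (1 - 3 / 4 * s) by rewrite /d; field.
  have : 0 < (1 - s) * (1 - 3 / 4 * s) by rewrite mulr_gt0 //; lra.
  by lra.
pose C := (1 + d^-1) ^+ 2 * B * (1 - s)^-1.
have cB0 : 0 <= (1 + d^-1) ^+ 2 * B by apply: mulr_ge0; [exact: sqr_ge0 | exact: ltW].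
have C0 : 0 <= C by apply: mulr_ge0 => //; rewrite invr_ge0 subr_ge0 ltW.
pose D := 1 + C / (1 - th).
have D0 : 0 <= D by rewrite addr_ge0 // divr_ge0 // ltW.
exists D; elim/ltn_ind => n IHn.
rewrite (ger0_norm (renewal_ge0 n)) -ler_pdivrMr ?cat4_gt0 //.
have [n0|n0] := posnP n.
  rewrite n0 fE fpsD fpsM big_ord1 K0 mul0r addr0 /catalan_fps /= expr0 mulr1 divr1.
  by rewrite lerDl divr_ge0 // ltW.
rewrite fE fpsD fps1 gtn_eqF // add0r fpsM mulr_suml.
apply: (@le_trans _ _ (\sum_(k < n.+1)
    ((1 + d^-1) ^+ 2 * B * f (n - k)%N + (1 + d) ^+ 2 * D * K k))).
  apply: ler_sum => -[k /= kn] _; rewrite ltnS in kn.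
  have Kf0 : 0 <= K k * f (n - k)%N by rewrite mulr_ge0 // renewal_ge0.
  apply: le_trans (ler_wpM2l Kf0 (inv_cat4_add d0 kn)) _; rewrite mulrDr; apply: lerD.
    have -> : K k * f (n - k)%N * ((1 + d^-1) ^+ 2 / p k) =
       (1 + d^-1) ^+ 2 * (K k / p k) * f (n - k)%N by ring.
    rewrite ler_wpM2r ?renewal_ge0 // ler_wpM2l ?sqr_ge0 // ler_pdivrMr ?cat4_gt0 //.
    exact: le_trans (ler_norm _) (KB k).
  have -> : K k * f (n - k)%N * ((1 + d) ^+ 2 / p (n - k)%N) =
       (1 + d) ^+ 2 * (f (n - k)%N / p (n - k)%N) * K k by ring.
  case: k kn {Kf0} => [|k] kn; first by rewrite K0 !mulr0.
  rewrite ler_wpM2r // ler_wpM2l ?sqr_ge0 // ler_pdivrMr ?cat4_gt0 //.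
  by apply: le_trans (ler_norm _) (IHn _ _); lia.
rewrite big_split /= -!mulr_sumr.
apply: (@le_trans _ _ (C + th * D)).
  apply: lerD.
    rewrite /C ler_wpM2l //.
    rewrite (reindex_inj rev_ord_inj) /=.
    rewrite (eq_bigr (fun k : 'I_n.+1 => f k)); last first.
      by move=> k _; rewrite subSS subKn // -ltnS.
    by rewrite -(big_mkord xpredT f); exact: renewal_series_le.
  have -> : th * D = (1 + d) ^+ 2 * D * s by rewrite /th; ring.
  rewrite ler_wpM2l //; first by apply: mulr_ge0 => //; exact: sqr_ge0.
  rewrite -(big_mkord xpredT K).
  exact: (nneg_series_le_lim _ K_ge0 asyK.2).
have : C = (D - 1) * (1 - th) by rewrite /D [1 + _]addrC addrK divfK // gt_eqF.
by move=> ->; nra.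
Qed.

Lemma dominatedM u v B B' : dominated u B -> dominated v B' ->
  exists B'', dominated (u * v : fps R) B''.
Proof.
move=> uB vB.
have /cvg_ex[/= U uU] := dominated_abs_cvg uB; have /cvg_ex[/= V vV] := dominated_abs_cvg vB.
have B0 : 0 <= B by have := le_trans (normr_ge0 _) (uB 0%N); rewrite pmulr_lge0 // cat4_gt0.
have B'0 : 0 <= B' by have := le_trans (normr_ge0 _) (vB 0%N); rewrite pmulr_lge0 // cat4_gt0.
exists (4 * B * V + 4 * B' * U) => n; rewrite -ler_pdivrMr ?cat4_gt0 //.
apply: (@le_trans _ _ (\sum_(k < n.+1)
    (4 * B * `|v (n - k)%N| + 4 * B' * `|u k|))).
  rewrite ler_pdivrMr ?cat4_gt0 // -ler_pdivrMr ?cat4_gt0 //.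
  apply: (@le_trans _ _ ((\sum_(k < n.+1) `|u k * v (n - k)%N|) / p n)).
    by rewrite ler_pM2r ?invr_gt0 ?cat4_gt0 // fpsM; exact: ler_norm_sum.
  rewrite mulr_suml; apply: ler_sum => -[k /= kn] _; rewrite ltnS in kn.
  apply: le_trans (ler_wpM2l (normr_ge0 _) (inv_cat4_add ltr01 kn)) _.
  rewrite invr1 normrM mulrDr; apply: lerD.
    have -> : `|u k| * `|v (n - k)%N| * ((1 + 1) ^+ 2 / p k) =
       4 * (`|u k| / p k) * `|v (n - k)%N| by ring.
    by rewrite ler_wpM2r // ler_wpM2l // ler_pdivrMr ?cat4_gt0.
  have -> : `|u k| * `|v (n - k)%N| * ((1 + 1) ^+ 2 / p (n - k)%N) =
       4 * (`|v (n - k)%N| / p (n - k)%N) * `|u k| by ring.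
  by rewrite ler_wpM2r // ler_wpM2l // ler_pdivrMr ?cat4_gt0.
rewrite big_split /= -!mulr_sumr; apply: lerD; rewrite ler_wpM2l ?mulr_ge0 //.
  rewrite (reindex_inj rev_ord_inj) /=.
  rewrite (eq_bigr (fun k : 'I_n.+1 => `|v k|)); last first.
    by move=> k _; rewrite subSS subKn // -ltnS.
  rewrite -(big_mkord xpredT (fun k => `|v k|)).
  by apply: nneg_series_le_lim vV.
rewrite -(big_mkord xpredT (fun k => `|u k|)).
by apply: nneg_series_le_lim uU.
Qed.

Lemma cvg_natrV : (fun n => n%:R^-1 : R) @ \oo --> (0 : R).
Proof. by rewrite -cvg_shiftS; exact: cvg_harmonic. Qed.

Lemma cvg_natr_ratio k : (fun n => k%:R / n%:R : R) @ \oo --> (0 : R).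
Proof. by rewrite -(mulr0 k%:R); apply: cvgM; [exact: cvg_cst | exact: cvg_natrV]. Qed.

Lemma cvg_subn_ratio k : (fun n => (n - k)%:R / n%:R : R) @ \oo --> (1 : R).
Proof.
have : (fun n => 1 - k%:R / n%:R : R) @ \oo --> (1 : R).
  by rewrite -[X in _ --> X](subr0 1); apply: cvgB; [exact: cvg_cst | exact: cvg_natr_ratio].
apply: cvg_trans; apply: near_eq_cvg; near=> n.
have kn : (k < n)%N by near: n; exact: nbhs_infty_gt.
rewrite natrB; last exact: ltnW.
by field; rewrite pnatr_eq0; lia.
Unshelve. all: by end_near. Qed.

(* Logarithmic differentiation of [f = 1 / (1 - K)] gives
   [n f_n = \sum_k k K_k (f * f)_(n - k)], where the factor [k / n] kills the
   terms with small [k]. *)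
Lemma renewal_coef n : n%:R * f n = \sum_(k < n.+1) k%:R * (K k * (f * f) (n - k)%N).
Proof.
have E : fps_theta f = fps_theta K * (f * f).
  have fK : f * (1 - K) = 1 by rewrite mulrBr mulr1 {1}fE; ring.
  have tE : fps_theta f * (1 - K) = fps_theta K * f.
    have t1 : fps_theta (1 : fps R) = 0.
      by apply/funext => -[|m]; rewrite /fps_theta fps1 ?mul0r ?mulr0.
    have tD : fps_theta f = fps_theta (1 : fps R) + fps_theta (K * f).
      by apply/funext => m; rewrite {1}fE /fps_theta !fpsD mulrDr.
    by rewrite mulrBr mulr1 {1}tD t1 fps_thetaM; ring.
  transitivity (fps_theta f * (1 - K) * f); first by rewrite -mulrA [_ * f]mulrC fK mulr1.
  by rewrite tE; ring.
have := congr1 (fun u : fps R => u n) E; rewrite /fps_theta fpsM => ->.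
by apply: eq_bigr => k _; rewrite mulrA.
Qed.

(** For [k] near [n] the asymptotics of [K] multiplies the full sum [(1 - s)^-2] of [f^2], with
    weight tending to 1. For small [k] only the domination of [f^2] is known, which suffices against
    a weight tending to 0. *)
Lemma renewal_asy : asy f (kappa / (1 - s) ^+ 2) (1 - s)^-1.
Proof.
split; last exact: renewal_sum.
have [B fB] := renewal_dominated; have [Bv vB] := dominatedM fB fB.
have [BK _ KB] := asy_dominated asyK.
have vs := series_fpsM_cvg (dominated_abs_cvg fB) renewal_sum renewal_sum.
pose c1 n k : R := k%:R / n%:R * (k.*2 <= n)%:R.
pose c2 n k : R := (n - k)%:R / n%:R * (k.*2 < n)%:R.
have ratio1 k n : (k <= n)%N -> 0 <= (k%:R / n%:R : R) <= 1.
  move=> kn; rewrite divr_ge0 //=; have [->|n0] := posnP n; first by rewrite invr0 mulr0.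
  by rewrite ler_pdivrMr ?ltr0n // mul1r ler_nat.
have c1_le1 n k : `|c1 n k| <= 1.
  rewrite /c1; case: leqP => kn; last by rewrite mulr0 normr0.
  have kn' : (k <= n)%N by rewrite -addnn in kn; lia.
  by have [h0 h1] := andP (ratio1 k n kn'); rewrite mulr1 ger0_norm.
have c2_le1 n k : `|c2 n k| <= 1.
  rewrite /c2; have [h0 h1] := andP (ratio1 (n - k)%N n (leq_subr k n)).
  by rewrite normrM (ger0_norm h0) mulr_ile1 // norm_natb.
have H1 : (fun n => (\sum_(k < n.+1) c1 n k * (K k * (f * f) (n - k)%N)) / p n) @ \oo -->
    limn (series (fun k => K k * (0 : R))).
  apply: (@half_convolution_cvg _ K (f * f) Bv c1 (fun=> 0) (dominated_abs_cvg KB) vB) => //.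
    by move=> n k nk; rewrite /c1 leqNgt nk mulr0.
  move=> k.
  have Bv0 : 0 <= Bv by have := le_trans (normr_ge0 _) (vB 0%N); rewrite pmulr_lge0 // cat4_gt0.
  apply/norm_cvg0P.
  apply: (@squeeze_cvgr _ _ _ _ (fun=> 0) (fun n => k%:R / n%:R * (4 * Bv))).
  - near=> n; rewrite normr_ge0 /= /c1.
    have kn : (k.*2 <= n)%N by near: n; exact: nbhs_infty_ge.
    rewrite kn mulr1 normrM ger0_norm ?divr_ge0 // ler_wpM2l ?divr_ge0 //.
    rewrite normrM normfV (gtr0_norm (cat4_gt0 R n)) ler_pdivrMr ?cat4_gt0 //.
    apply: le_trans (vB _) _.
    have -> : 4 * Bv * p n = Bv * (4 * p n) by ring.
    by rewrite ler_wpM2l //; apply: cat4_le_double; rewrite -?addnn in kn *; lia.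
  - exact: cvg_cst.
  - rewrite -(mul0r (4 * Bv)); apply: cvgM; last exact: cvg_cst.
    exact: cvg_natr_ratio.
have H2 : (fun n => (\sum_(k < n.+1) c2 n k * ((f * f) k * K (n - k)%N)) / p n) @ \oo -->
    limn (series (fun k => (f * f) k * kappa)).
  apply: (@half_convolution_cvg _ (f * f) K BK c2 (fun=> kappa) (dominated_abs_cvg vB) KB) => //.
    by move=> n k nk; rewrite /c2 ltnNge ltnW // mulr0.
  move=> k; rewrite /= -(mul1r kappa); apply: cvgM; last exact: ratio_shift asyK.1.
  rewrite -[X in _ --> X](mul1r 1); apply: cvgM; first exact: cvg_subn_ratio.
  exact: cvg_half_indicator_lt.
have := cvgD H1 H2; rewrite (lim_series_mulr _ asyK.2) mulr0 add0r (lim_series_mulr _ vs).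
have -> : (1 - s)^-1 * (1 - s)^-1 * kappa = kappa / (1 - s) ^+ 2.
  by rewrite -invfM -expr2 mulrC.
move=> /(_ _) H; apply: (cvg_trans _ H); apply: near_eq_cvg; near=> n.
have n0 : (0 < n)%N by near: n; exact: nbhs_infty_gt.
have nR : n%:R != 0 :> R by rewrite pnatr_eq0 -lt0n.
have -> : f n / p n = (\sum_(k < n.+1) c1 n k * (K k * (f * f) (n - k)%N) +
    \sum_(k < n.+1) c2 n k * ((f * f) k * K (n - k)%N)) / p n.
  congr (_ / _); apply: (mulfI nR); rewrite renewal_coef.
  have := convolution_halves (fun k => k%:R / n%:R) K (f * f) n.
  rewrite /c1 /c2 => <-; rewrite mulr_sumr; apply: eq_bigr => k _.
  by rewrite [RHS]mulrA [n%:R * _]mulrC divfK.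
by rewrite mulrDl.
Unshelve. all: by end_near. Qed.

End Renewal.

(** * The Wallis product *)

Section Wallis.
Variable R : realType.
Local Notation p := (catalan_fps (4^-1 : R)).

(* An antiderivative of [sin ^ n], from the reduction formula. *)
Fixpoint sin_primitive (n : nat) (x : R) : R :=
  match n with
  | 0 => x
  | 1 => - cos x
  | m.+2 => m.+1%:R / m.+2%:R * sin_primitive m x - m.+2%:R^-1 * (cos x * sin x ^+ m.+1)
  end.

Lemma is_derive_sin_primitive n x :
  is_derive x (1 : R) (sin_primitive n) (sin x ^+ n).
Proof.
suff [] : is_derive x (1 : R) (sin_primitive n) (sin x ^+ n) /\
  is_derive x (1 : R) (sin_primitive n.+1) (sin x ^+ n.+1) by [].
elim: n => [|n [IH1 IH2]].
  split; first by rewrite expr0; exact: is_derive_id.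
  by rewrite expr1 -[X in is_derive _ _ _ X]opprK; exact: is_deriveN.
split; first exact: IH2.
have D1 := is_deriveZ (n.+1%:R / n.+2%:R) IH1.
have D2 := is_deriveX n.+1 (is_derive_sin x); rewrite exprfctE in D2.
have D := is_deriveB D1 (is_deriveZ (n.+2%:R^-1) (is_deriveM (is_derive_cos x) D2)).
suff E : sin x ^+ n.+2 = n.+1%:R / n.+2%:R * sin x ^+ n -
    n.+2%:R^-1 * (cos x * (n.+1%:R * sin x ^+ n * cos x) + sin x ^+ n.+1 * - sin x).
  by rewrite E; exact: D.
have -> : n.+2%:R = n%:R + 2 :> R by rewrite -addn2 natrD.
have -> : n.+1%:R = n%:R + 1 :> R by rewrite -addn1 natrD.
have x0 := ler0n R n; have := cos2Dsin2 x; rewrite !exprS.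
move: (cos x) (sin x) (sin x ^+ n) => c s S cs.
have n2 : n%:R + 2 != 0 :> R by rewrite gt_eqF //; lra.
have c2 : c * c = 1 - s * s by rewrite -cs; ring.
transitivity (((n%:R + 1) * S * (1 - c * c) + s * s * S) / (n%:R + 2)); last by field.
by rewrite c2; field.
Qed.

(** The integral of [sin ^ n] over [[0, pi / 2]]. *)
Definition wallis (n : nat) : R := sin_primitive n (pi / 2) - sin_primitive n 0.

Lemma wallis_mono n : wallis n.+1 <= wallis n.
Proof.
pose G x := sin_primitive n x - sin_primitive n.+1 x.
have dG x : is_derive x (1 : R) G (sin x ^+ n - sin x ^+ n.+1).
  by apply: is_deriveB; exact: is_derive_sin_primitive.
suff : G 0 <= G (pi / 2) by rewrite /G /wallis; lra.
have pi0 := pi_ge0 R.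
apply: (@ger0_derive1_ndecr R G 0 (pi / 2)) => //; last by rewrite divr_ge0.
- move=> x; rewrite in_itv /= => /andP[x0 xpi].
  rewrite derive1E (@derive_val _ _ _ _ _ _ _ (dG x)).
  have s0 : 0 <= sin x by apply: sin_ge0_pi; rewrite (ltW x0) /=; lra.
  by rewrite exprS -[X in X - _]mul1r -mulrBl mulr_ge0 ?subr_ge0 ?sin_le1 // exprn_ge0.
- by apply: continuous_subspaceT => x; apply: differentiable_continuous; apply/derivable1_diffP.
Qed.

Lemma wallis0 : wallis 0 = pi / 2.
Proof. by rewrite /wallis /= subr0. Qed.

Lemma wallis1 : wallis 1 = 1.
Proof. by rewrite /wallis /= cos0 cos_pihalf oppr0 sub0r opprK. Qed.

Lemma wallisSS n : wallis n.+2 = n.+1%:R / n.+2%:R * wallis n.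
Proof. by rewrite /wallis /= cos_pihalf sin0 expr0n /= mul0r !mulr0 !subr0 mulrBr. Qed.
(** The central binomial coefficient of [2 n] over [n], divided by [4 ^ n]. *)
Definition central (n : nat) : R := n.+1%:R * p n.

Lemma central_gt0 n : 0 < central n.
Proof. by rewrite mulr_gt0 ?cat4_gt0. Qed.

Lemma centralS n : central n.+1 = (2 * n%:R + 1) / (2 * n%:R + 2) * central n.
Proof.
rewrite /central cat4S; have x0 := ler0n R n.
have -> : n.+2%:R = n%:R + 2 :> R by rewrite -addn2 natrD.
have -> : n.+1%:R = n%:R + 1 :> R by rewrite -addn1 natrD.
by field; do ?[apply/andP; split] => //; rewrite gt_eqF //; lra.
Qed.

Lemma wallis_even n : wallis n.*2 = pi / 2 * central n.
Proof.
elim: n => [|n IHn]; first by rewrite wallis0 /central /catalan_fps /= expr0 !mulr1.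
rewrite doubleS wallisSS IHn centralS; have x0 := ler0n R n.
have -> : n.*2.+2%:R = 2 * n%:R + 2 :> R by rewrite -addn2 natrD -mul2n natrM.
have -> : n.*2.+1%:R = 2 * n%:R + 1 :> R by rewrite -addn1 natrD -mul2n natrM.
ring.
Qed.

Lemma wallis_odd n : wallis n.*2.+1 = ((2 * n%:R + 1) * central n)^-1.
Proof.
elim: n => [|n IHn].
  by rewrite wallis1 /central /catalan_fps /= expr0 mulr0 add0r !mulr1 invr1.
rewrite doubleS wallisSS IHn centralS; have x0 := ler0n R n.
have -> : n.*2.+3%:R = 2 * n%:R + 3 :> R by rewrite -addn3 natrD -mul2n natrM.
have -> : n.*2.+2%:R = 2 * n%:R + 2 :> R by rewrite -addn2 natrD -mul2n natrM.
have -> : n.+1%:R = n%:R + 1 :> R by rewrite -addn1 natrD.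
have := central_gt0 n; move: (central n) => b b0.
by field; do ?[apply/andP; split] => //; rewrite gt_eqF //; lra.
Qed.

(** Wallis' sandwich: the integrals of exponents [2 n + 2], [2 n + 1] and [2 n] are nondecreasing in
    this order. *)
Lemma central_sqr_bounds n :
  2 / (pi * (2 * n%:R + 1)) <= central n ^+ 2 <= 2 * (2 * n%:R + 2) / (pi * (2 * n%:R + 1) ^+ 2).
Proof.
have := wallis_mono n.*2.+1; rewrite -doubleS wallis_odd wallis_even centralS.
have := wallis_mono n.*2; rewrite wallis_odd wallis_even.
have x0 := ler0n R n; have := central_gt0 n; move: (central n) (n%:R : R) x0 => b x x0 b0.
have pi0 := pi_gt0 R; have y0 : 0 < 2 * x + 1 by lra.
have yb : 0 < (2 * x + 1) * b by rewrite mulr_gt0.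
rewrite -div1r ler_pdivrMr // => H1.
move=> H2'; have {H2'} H2 : pi / 2 * ((2 * x + 1) / (2 * x + 2) * b) * ((2 * x + 1) * b) <= 1.
  by rewrite -ler_pdivlMr // div1r.
apply/andP; split.
  rewrite ler_pdivrMr ?mulr_gt0 //.
  have : 2 <= 2 * (pi / 2 * b * ((2 * x + 1) * b)) by lra.
  by have -> : 2 * (pi / 2 * b * ((2 * x + 1) * b)) = b ^+ 2 * (pi * (2 * x + 1)) by field.
rewrite ler_pdivlMr; last by rewrite mulr_gt0 // exprn_gt0.
have z0 : 0 < 2 * x + 2 by lra.
have : pi / 2 * ((2 * x + 1) / (2 * x + 2) * b) * ((2 * x + 1) * b) * (2 * (2 * x + 2)) <=
  1 * (2 * (2 * x + 2)) by rewrite ler_pM2r // ?mulr_gt0.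
have -> : pi / 2 * ((2 * x + 1) / (2 * x + 2) * b) * ((2 * x + 1) * b) * (2 * (2 * x + 2)) =
  b ^+ 2 * (pi * (2 * x + 1) ^+ 2) by field; rewrite gt_eqF.
by rewrite mul1r.
Qed.

Lemma cvg_central_sqr : (fun n => n%:R * central n ^+ 2) @ \oo --> (pi^-1 : R).
Proof.
have pi0 := pi_gt0 R.
have H0 : (fun n => (n.*2.+1)%:R^-1 : R) @ \oo --> (0 : R).
  apply: (@squeeze_cvgr _ _ _ _ (fun=> 0) (fun n => (n.+1%:R)^-1)).
  - by near=> n; rewrite invr_ge0 ler0n /= lef_pV2 ?posrE // ler_nat -addnn; lia.
  - exact: cvg_cst.
  - exact: cvg_harmonic.
have E n : n.*2.+1%:R = 2 * n%:R + 1 :> R by rewrite -addn1 natrD -mul2n natrM.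
have H : (fun n => n%:R / (2 * n%:R + 1) : R) @ \oo --> (2^-1 : R).
  have : (fun n => 2^-1 * (1 - (n.*2.+1)%:R^-1) : R) @ \oo --> (2^-1 * (1 - 0) : R).
    by apply: cvgM; [exact: cvg_cst | apply: cvgB => //; exact: cvg_cst].
  rewrite subr0 mulr1; apply: cvg_trans; apply: near_eq_cvg; near=> n.
  by have x0 := ler0n R n; rewrite E; field; rewrite gt_eqF //; lra.
have H1 : (fun n => 2 / pi * (n%:R / (2 * n%:R + 1))) @ \oo --> (pi^-1 : R).
  have : (fun n => 2 / pi * (n%:R / (2 * n%:R + 1))) @ \oo --> (2 / pi * 2^-1 : R).
    by apply: cvgM => //; exact: cvg_cst.
  rewrite (_ : 2 / pi * 2^-1 = pi^-1) //.
  by move: (pi : R) pi0 => q q0; field; rewrite gt_eqF.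
apply: (@squeeze_cvgr _ _ _ _ (fun n => 2 / pi * (n%:R / (2 * n%:R + 1)))
  (fun n => 2 / pi * (n%:R / (2 * n%:R + 1)) * (1 + (n.*2.+1)%:R^-1))) => //.
- near=> n; have /andP[h1 h2] := central_sqr_bounds n; have x0 := ler0n R n.
  have y0 : 0 < 2 * n%:R + 1 :> R by lra.
  have -> : 2 / pi * (n%:R / (2 * n%:R + 1)) = n%:R * (2 / (pi * (2 * n%:R + 1))) :> R.
    by move: (pi : R) pi0 => q q0; field; rewrite !gt_eqF.
  rewrite E ler_wpM2l //=.
  have -> : n%:R * (2 / (pi * (2 * n%:R + 1))) * (1 + (2 * n%:R + 1)^-1) =
    n%:R * (2 * (2 * n%:R + 2) / (pi * (2 * n%:R + 1) ^+ 2)) :> R.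
    by move: (pi : R) pi0 => q q0; field; rewrite !gt_eqF.
  by rewrite ler_wpM2l.
- have : (fun n => 2 / pi * (n%:R / (2 * n%:R + 1)) * (1 + (n.*2.+1)%:R^-1)) @ \oo -->
      (pi^-1 * (1 + 0) : R).
    by apply: cvgM => //; apply: cvgD => //; exact: cvg_cst.
  by rewrite addr0 mulr1.
Unshelve. all: by end_near. Qed.

(** The term is [sqrt (n * central n ^ 2)] times [n / (n + 1)]. *)
Lemma cvg_cat4_power : (fun n => p n * (n%:R * Num.sqrt n%:R)) @ \oo --> ((Num.sqrt pi)^-1 : R).
Proof.
have H : (fun n => Num.sqrt (n%:R * central n ^+ 2)) @ \oo --> (Num.sqrt pi^-1 : R).
  by apply: continuous_cvg; [exact: sqrt_continuous | exact: cvg_central_sqr].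
have H2 : (fun n => 1 - n.+1%:R^-1 : R) @ \oo --> (1 - 0 : R).
  by apply: cvgB; [exact: cvg_cst | exact: cvg_harmonic].
have := cvgM H H2; rewrite subr0 mulr1 sqrtrV ?pi_ge0 //.
move=> /(_ _) H3; apply: (cvg_trans _ H3); apply: near_eq_cvg; near=> n.
rewrite /= sqrtrM // sqrtr_sqr ger0_norm ?ltW ?central_gt0 // /central.
have x0 := ler0n R n; rewrite -[n.+1]addn1 natrD.
by field; rewrite gt_eqF //; lra.
Unshelve. all: by end_near. Qed.

End Wallis.

(** * The constants *)

Section Constants.
Variable R : realType.
Implicit Types (u v : fps R) (n k : nat).
Local Notation p := (catalan_fps (4^-1 : R)).
Local Notation fX := (fpsX R).
Local Notation "c %:S" := (fps_const c) (at level 1, format "c %:S").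
Local Notation x := (6%:R^-1%:S * fX).

Lemma asy_eq u (l l' s s' : R) : asy u l s -> l = l' -> s = s' -> asy u l' s'.
Proof. by move=> H <- <-. Qed.

Lemma asy_natr m : asy (m%:R : fps R) 0 m%:R.
Proof. by rewrite -(rmorph_nat (@fps_const R)); exact: asy_const. Qed.

Lemma asy_scaleX (a : R) : asy (a%:S * fX) 0 a.
Proof. by apply: (asy_eq (asyZ a (asy_X R))); ring. Qed.

Lemma catalan_sumE (a l s : R) : a != 0 -> asy (catalan_fps a) l s -> s = 1 + a * s ^+ 2.
Proof.
move=> a0 H; have H2 := asyD (asy_natr 1) (asyM (asy_scaleX a) (asyM H H)).
rewrite -expr2 -(catalan_fpsE a0) in H2.
by rewrite expr2; apply: (asy_sum_unique H H2).
Qed.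

Lemma asy_cat4 : asy p 1 2.
Proof.
have pp : (fun n => p n / p n) @ \oo --> (1 : R).
  by under eq_fun do rewrite divff ?cat4_neq0 //; exact: cvg_cst.
have [s Hs] := ratio_asy pp.
suff <- : s = 2 by [].
have := catalan_sumE _ Hs; rewrite invr_eq0 pnatr_eq0 => /(_ isT) E.
have : (s - 2) ^+ 2 = 0 by rewrite sqrrB; lra.
by move/eqP; rewrite expf_eq0 /= subr_eq0 => /eqP.
Qed.

(** The ratio to [p n] is exactly [(4 a)^n]. Comparison with the series of [p] gives [|s| <= 2],
    which selects a root of the quadratic equation in the two evaluations below. *)
Lemma asy_catalan_small (a : R) : a != 0 -> `|a| < 4^-1 ->
  exists s, [/\ asy (catalan_fps a) 0 s, s = 1 + a * s ^+ 2 & `|s| <= 2].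
Proof.
move=> a0 a4.
have H : (fun n => catalan_fps a n / p n) @ \oo --> (0 : R).
  have : (fun n => (4 * a) ^+ n) @ \oo --> (0 : R).
    by apply: cvg_expr; rewrite normrM (ger0_norm (ler0n _ _)); lra.
  apply: cvg_trans; apply: near_eq_cvg; near=> n.
  rewrite /catalan_fps exprMn; have := catalan_gt0 R n; move: (catalan R n) => c c0.
  by rewrite exprVn invfM invrK mulrACA divff ?gt_eqF // mul1r mulrC.
have [s Hs] := ratio_asy H; exists s; split=> //; first exact: catalan_sumE Hs.
apply: (cvgn_le_const (cvg_norm Hs.2)) => n.
apply: le_trans (series_cat4_le2 R n); apply: le_trans (ler_norm_sum _ _ _) _.
apply: ler_sum => k _; rewrite /catalan_fps normrM (ger0_norm (ltW (catalan_gt0 R k))).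
by rewrite ler_wpM2l ?(ltW (catalan_gt0 R k)) // normrX lerXn2r ?nnegrE // ltW.
Unshelve. all: by end_near. Qed.

Lemma sqrt3_sqr : Num.sqrt 3 ^+ 2 = 3 :> R.
Proof. by rewrite sqr_sqrtr. Qed.

Lemma sqrt3_gt0 : 0 < Num.sqrt 3 :> R.
Proof. by rewrite sqrtr_gt0. Qed.

Lemma asy_catalan6 : asy (catalan_fps (6^-1 : R)) 0 (3 - Num.sqrt 3).
Proof.
have [||s [Hs sE s2]] := @asy_catalan_small 6^-1.
- by rewrite invr_eq0 pnatr_eq0.
- by rewrite ger0_norm ?invr_ge0 //; lra.
suff <- : s = 3 - Num.sqrt 3 by [].
have r2 := sqrt3_sqr; have r0 := sqrt3_gt0; move: s2; rewrite ler_norml => /andP[_ s2].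
have : (3 - s) ^+ 2 = Num.sqrt 3 ^+ 2 by rewrite r2 sqrrB; lra.
by move/eqP; rewrite eqf_sqr => /orP[/eqP|/eqP]; lra.
Qed.

Lemma asy_catalan12 : asy (catalan_fps (- 12^-1 : R)) 0 (4 * Num.sqrt 3 - 6).
Proof.
have [||s [Hs sE s2]] := @asy_catalan_small (- 12^-1).
- by rewrite oppr_eq0 invr_eq0 pnatr_eq0.
- by rewrite normrN ger0_norm ?invr_ge0 //; lra.
suff <- : s = 4 * Num.sqrt 3 - 6 by [].
have r2 := sqrt3_sqr; have r0 := sqrt3_gt0; move: s2; rewrite ler_norml => /andP[s2 _].
have : (s + 6) ^+ 2 = (4 * Num.sqrt 3) ^+ 2 by rewrite exprMn r2 sqrrD; lra.
by move/eqP; rewrite eqf_sqr => /orP[/eqP|/eqP]; lra.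
Qed.

Lemma asy_geometric : asy (geometric_fps (- 2^-1 : R)) 0 (2 / 3).
Proof.
(* Since [1 / p n <= (n + 1)^2], any growth rate below 2 would beat [2^-n]; the rate 3/2 needs four
   small cases before the ratio of squares drops below it. *)
have bound n : n.+1%:R ^+ 2 <= 8 * (3 / 2) ^+ n :> R.
  elim: n => [|n IHn]; first by rewrite !expr0 expr1n; lra.
  have [n4|n4] := ltnP n 4.
    by case: n n4 {IHn} => [|[|[|[|]]]] // _; rewrite !exprS !expr0; lra.
  have : n.+2%:R ^+ 2 <= (3 / 2) * n.+1%:R ^+ 2 :> R.
    have n4R : 4 <= n%:R :> R by rewrite ler_nat.
    have -> : n.+2%:R = n%:R + 2 :> R by rewrite -addn2 natrD.
    have -> : n.+1%:R = n%:R + 1 :> R by rewrite -addn1 natrD.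
    by nra.
  move/le_trans; apply; rewrite [in leRHS]exprS.
  by move: IHn; move: (n.+1%:R ^+ 2 : R) ((3 / 2 : R) ^+ n) => a b; lra.
have H : (fun n => geometric_fps (- 2^-1) n / p n) @ \oo --> (0 : R).
  apply/norm_cvg0P.
  apply: (@squeeze_cvgr _ _ _ _ (fun=> 0) (fun n => 8 * (3 / 4) ^+ n)).
  - near=> n; rewrite normr_ge0 /= normrM normfV (gtr0_norm (cat4_gt0 R n)).
    rewrite ler_pdivrMr ?cat4_gt0 // /geometric_fps normrX normrN ger0_norm ?invr_ge0 //.
    have := cat4_quadratic_mono R (leq0n n); rewrite expr1n mulr1.
    have -> : p 0%N = 1 by rewrite /catalan_fps /= expr0 mulr1.
    have -> : (3 / 4 : R) ^+ n = (3 / 2) ^+ n * 2^-1 ^+ n by rewrite -exprMn; congr (_ ^+ _); field.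
    have h2 : 0 < 2^-1 ^+ n :> R by rewrite exprn_gt0.
    have := bound n; have := cat4_gt0 R n; move: (p n) h2 => q.
    move: (2^-1 ^+ n) ((3 / 2) ^+ n) (n.+1%:R ^+ 2) => a b m a0 q0 mb H1.
    have : 1 <= 8 * b * q by apply: le_trans H1 _; rewrite mulrC ler_pM2r.
    by move=> h; have := ler_wpM2r (ltW a0) h; lra.
  - exact: cvg_cst.
  - rewrite -(mulr0 8); apply: cvgM; first exact: cvg_cst.
    by apply: cvg_expr; rewrite ger0_norm; lra.
have [s Hs] := ratio_asy H; suff <- : s = 2 / 3 by [].
have H2 := asyD (asy_natr 1) (asyM (asy_scaleX (- 2^-1)) Hs).
rewrite -geometric_fpsE in H2; have := asy_sum_unique Hs H2; lra.
Unshelve. all: by end_near. Qed.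

(** Only the factor at [X / 4] has a nonzero ratio limit. At 1 the two terms in [Q = 4 sqrt 3 - 6]
    cancel in the value, while the ratio limit is [(3 + Q / 2) / 3]. *)
Lemma asy_mu : asy (mu_fps R) (2 / 3 * Num.sqrt 3) 2.
Proof.
have H := asyM (asyM (asy_const 2^-1) (asyD
  (asyD (asyM (asy_natr 3) asy_cat4) (asyN asy_catalan12))
  (asyM (asyM (asyM (asy_natr 6) (asy_scaleX 12^-1)) asy_cat4) asy_catalan12)))
  asy_geometric.
by apply: (asy_eq H); field.
Qed.

(** The closed form has terms of both signs, but the quadratic equation computes each coefficient
    from earlier ones by sums and products of nonnegative numbers. *)
Lemma mu_ge0 n : 0 <= mu_fps R n.
Proof.
elim/ltn_ind: n => n IHn; rewrite mu_fpsE.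
have -> : 1 + (x + 3%:R * x ^+ 2) * mu_fps R ^+ 2 =
  1 + 6^-1%:S * (fX * (mu_fps R * mu_fps R + 3%:R%:S * (6^-1%:S * (fX * (mu_fps R * mu_fps R))))).
  by rewrite rmorph_nat; ring.
have w0 m : (m < n)%N -> 0 <= (mu_fps R * mu_fps R) m.
  by move=> mn; rewrite fpsM sumr_ge0 // => i _; rewrite mulr_ge0 // IHn //; case: i => i /= ?; lia.
rewrite fpsD fps1 addr_ge0 // fps_constM mulr_ge0 ?invr_ge0 // fpsXM.
case: n w0 {IHn} => // n w0; rewrite fpsD !fps_constM fpsXM addr_ge0 ?w0 // !mulr_ge0 ?invr_ge0 //.
by case: n w0 => // n w0; rewrite w0.
Qed.

End Constants.

(** * Conclusion *)

Lemma asy_nonnesting_avoiders (R : realType) :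
  (fun n => (c n)%:R / 6 ^+ n / catalan_fps (4^-1 : R) n) @ \oo -->
  ((9 + 6 * Num.sqrt 3) / 8 : R).
Proof.
set r : R := Num.sqrt 3; have r2 : r ^+ 2 = 3 := sqrt3_sqr R.
pose C := catalan_fps (6^-1 : R); pose D := 2%:R * (C - 1) - fps_const 6^-1 * fpsX R.
pose K := mu_fps R * D.
have C0 : C 0%N = 1 by rewrite /C /catalan_fps /= expr0 mulr1.
have C1 : C 1%N = 6^-1 by rewrite /C /catalan_fps /= expr1; field.
have Cge0 n : 0 <= C n by rewrite mulr_ge0 ?exprn_ge0 // ltW // catalan_gt0.
have DE n : D n = 2 * (C n - (n == 0%N)%:R) - 6^-1 * (n == 1%N)%:R.
  by rewrite /D -(rmorph_nat (@fps_const R)) fpsD fpsN !fps_constM fpsD fpsN fps1.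
have D0 n : 0 <= D n.
  rewrite DE; case: n => [|[|n]] /=; [rewrite C0; lra | rewrite C1; lra |].
  by rewrite mulr0 !subr0 mulr_ge0.
have K_ge0 n : 0 <= K n by rewrite /K fpsM sumr_ge0 // => i _; rewrite mulr_ge0 ?mu_ge0.
have K0 : K 0%N = 0.
  by rewrite /K fpsM big_ord1 subnn DE C0 /=; ring.
have asyC1 := asyD (asy_catalan6 R) (asyN (asy_natr R 1)).
have asyD' := asyD (asyM (asy_natr R 2) asyC1) (asyN (asy_scaleX 6^-1)).
have asyK := asyM (asy_mu R) asyD'.
have [f fE] := fps_geometric_inverse K0.
rewrite -/r in asyC1 asyD' asyK.
(* The series [D] sums to [2 (2 - r) - 1/6 = 23/6 - 2 r]. Multiplied by the value 2 of [M] this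
   gives [s]; multiplied by the ratio limit of [M] it gives that of [K]. *)
pose s := 23 / 3 - 4 * r.
have asyK' : asy K (2 / 3 * r * (23 / 6 - 2 * r)) s.
  by apply: (asy_eq asyK); rewrite /s; field.
have r0 : 0 <= r by rewrite sqrtr_ge0.
have s1 : s < 1.
  have : 5 / 3 < r.
    rewrite ltNge; apply/negP => h.
    have : r ^+ 2 <= (5 / 3) ^+ 2 by rewrite ler_sqr ?nnegrE //; lra.
    by rewrite r2; lra.
  by rewrite /s; lra.
have asyf := renewal_asy K_ge0 K0 asyK' s1 fE.
(* The denominator is rationalised by [(3 r - 5) (3 r + 5) = 2]. *)
have F : (1 - s)^-1 = 3 * (3 * r + 5) / 8.
  have E : 1 - s = 4 / 3 * (3 * r - 5) by rewrite /s; field.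
  apply: (mulIf (x := 1 - s)); first by rewrite gt_eqF // subr_gt0.
  rewrite mulVf; last by rewrite gt_eqF // subr_gt0.
  transitivity ((9 * r ^+ 2 - 25) / 2); first by rewrite r2; field.
  by rewrite E; field.
have asyc := asyD (asy_catalan6 R)
  (asyM (asyM (asyM (asy_natr R 2) (asyM asyC1 asyC1)) asyf) (asy_mu R)).
have cE n : (c n)%:R / 6 ^+ n = (C + 2%:R * ((C - 1) * (C - 1)) * f * mu_fps R : fps R) n.
  by rewrite c_paths (paths_fps fE) expr2.
under eq_fun do rewrite cE.
rewrite -/r in asyc; apply: (proj1 (asy_eq asyc _ erefl)).
have q1 : (1 - s)^-1 * (1 - s) = 1 by rewrite mulVf // gt_eqF // subr_gt0.
rewrite -exprVn; move: (1 - s)^-1 F q1 => q F; rewrite {1}/s => q1.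
(* The ratio limit of [K] is [r s / 3], so the contributions of [f] and [M] add up to
   [4/3 r (2 - r)^2 (s q^2 + q)], and [s q + 1 = q] makes this a square times [4/3 r]. The second
   summand is the error, which vanishes by [q1]. *)
transitivity (4 / 3 * r * ((2 - r) * q) ^+ 2 +
  4 / 3 * (2 - r) ^+ 2 * r * (q - q * (q * (1 - (23 / 3 - 4 * r))))); first by field.
rewrite q1 mulr1 subrr mulr0 addr0.
have -> : (2 - r) * q = 3 / 8 * (1 + r).
  transitivity (3 / 8 * (r + 10 - 3 * r ^+ 2)); first by rewrite F; field.
  by rewrite r2; field.
transitivity (3 / 16 * (r + 2 * r ^+ 2 + r * r ^+ 2)); first by field.
by rewrite r2; field.
Qed.

Theorem corollary1p3 (R : realType) :
  (fun n : nat =>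
     (c n)%:R /
     ((9 + 6 * Num.sqrt 3) / (8 * Num.sqrt pi) * 6 ^+ n * n%:R `^ (- (3 / 2))))
  @ \oo --> (1 : R).
Proof.
have pi0 : 0 < Num.sqrt pi :> R by rewrite sqrtr_gt0 pi_gt0.
have k0 : 0 < 9 + 6 * Num.sqrt 3 :> R by have := sqrt3_gt0 R; lra.
have H := cvgM (cvgM (@asy_nonnesting_avoiders R) (@cvg_cat4_power R))
  (cvg_cst ((9 + 6 * Num.sqrt 3) / (8 * Num.sqrt pi) : R)^-1).
have {H} : (fun n => (c n)%:R / 6 ^+ n / catalan_fps (4^-1 : R) n *
    (catalan_fps (4^-1 : R) n * (n%:R * Num.sqrt n%:R)) *
    ((9 + 6 * Num.sqrt 3) / (8 * Num.sqrt pi) : R)^-1) @ \oo --> (1 : R).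
  rewrite [X in _ --> X](_ : 1 = (9 + 6 * Num.sqrt 3) / 8 * (Num.sqrt pi)^-1 *
     ((9 + 6 * Num.sqrt 3) / (8 * Num.sqrt pi))^-1); first exact: H.
  by field; rewrite !gt_eqF.
apply: cvg_trans; apply: near_eq_cvg; near=> n.
have n0 : 0 < n%:R :> R by rewrite ltr0n; near: n; exact: nbhs_infty_gt.
have -> : n%:R `^ (- (3 / 2)) = (n%:R * Num.sqrt n%:R)^-1 :> R.
  have -> : n%:R * Num.sqrt n%:R = n%:R `^ 1 * n%:R `^ 2^-1 :> R.
    by rewrite powR12_sqrt ?powRr1 // ltW.
  rewrite powRN -powRD; last by rewrite gt_eqF // implybT.
  by congr (_ `^ _)^-1; field.
have p0 := cat4_gt0 R n; have s6 : 0 < 6 ^+ n :> R by rewrite exprn_gt0.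
move: (catalan_fps _ n) p0 (6 ^+ n) s6 (n%:R : R) n0.
move=> q q0 t t0 b b0; move: (Num.sqrt pi) (9 + 6 * Num.sqrt 3) pi0 k0 => d e d0 e0.
by field; rewrite !gt_eqF // sqrtr_gt0.
Unshelve. all: by end_near. Qed.
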